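(* Let $M$ be a finite-dimensional connected manifold with corners, let $\pi\colon E\to M$ be a locally trivial smooth bundle with a locally convex manifold $N$ as typical fibre, and let $\sigma\colon M\to E$ be a continuous section of $\pi$. Let $L\subseteq M$ be closed and $U\subseteq M$ be open such that $\sigma$ is smooth on a neighbourhood of $L\setminus U$. Then for each open neighbourhood $O$ of $\sigma(M)$ in $E$ there exists a continuous section $\tau\colon M\to E$ of $\pi$ with $\tau(M)\subseteq O$ which is smooth on a neighbourhood of $L$ and satisfies $\tau(x)=\sigma(x)$ for all $x\in M\setminus U$. Furthermore, there exists a homotopy $F\colon[0,1]\times M\to O$ between $\sigma$ and $\tau$ (i.e. a continuous map with $F(0,\cdot)=\sigma$ and $F(1,\cdot)=\tau$) such that $F(t,\cdot)$ is a section of $\pi$ for each $t\in[0,1]$ and $F(t,x)=\sigma(x)=\tau(x)$ for all $(t,x)\in[0,1]\times(M\setminus U)$.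
   Context: Locally convex spaces are real Hausdorff locally convex topological vector spaces. Differential calculus: let $X,Y$ be locally convex spaces and $V\subseteq X$ open. A map $f\colon V\to Y$ is $C^1$ if it is continuous, for all $x\in V$, $v\in X$ the limit $df(x).v:=\lim_{h\to0}\frac1h(f(x+hv)-f(x))$ exists, and $df\colon V\times X\to Y$ is continuous. For $n>1$ define recursively $d^nf(x).(v_1,\dots,v_n):=\lim_{h\to0}\frac1h\big(d^{n-1}f(x+hv_n).(v_1,\dots,v_{n-1})-d^{n-1}f(x).(v_1,\dots,v_{n-1})\big)$; $f$ is $C^n$ if $d^kf\colon V\times X^k\to Y$ exists and is continuous for all $k=1,\dots,n$, and smooth if it is $C^n$ for all $n\in\mathbb N$. A locally convex manifold is a Hausdorff space in which each point has a neighbourhood homeomorphic to an open subset of some locally convex space, such that the coordinate changes are smooth (together with a fixed such differentiable structure). A ($d$-dimensional, finite-dimensional) manifold with corners is a paracompact Hausdorff space in which each point has a neighbourhood homeomorphic to an open subset of $\mathbb R^d_+=\{x\in\mathbb R^d: x_i\ge0 \text{ for all } i\}$, with smooth coordinate changes. Here a map $f\colon A\subseteq\mathbb R^n\to\mathbb R^m$ is smooth if each $x\in A$ has an open neighbourhood $U_x$ in $\mathbb R^n$ and a smooth map $f_x\colon U_x\to\mathbb R^m$ with $f_x=f$ on $A\cap U_x$. More generally, a continuous map from a (not necessarily open) domain with dense interior in a locally convex space into a locally convex space is smooth if it is smooth on the interior and all its differentials $d^nf$ extend continuously to the boundary; smooth maps on manifolds with corners (possibly modelled on locally convex spaces) are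 defined in charts accordingly. A locally trivial smooth bundle with typical fibre $N$ is a smooth map $\pi\colon E\to M$, where $E$ is a manifold (with corners) modelled on locally convex spaces, such that $M$ has an open cover $(S_t)_{t\in T}$ with diffeomorphisms $\varphi_t\colon\pi^{-1}(S_t)\to S_t\times N$ satisfying $\mathrm{pr}_1\circ\varphi_t=\pi|_{\pi^{-1}(S_t)}$. A section of $\pi$ is a map $\sigma\colon M\to E$ with $\pi\circ\sigma=\mathrm{id}_M$. *)

(* Defs.v *)
From HB Require Import structures.
From mathcomp Require Import all_boot all_order all_algebra.
From mathcomp Require Import all_classical all_reals all_analysis.
Set Implicit Arguments.
Unset Strict Implicit.
Unset Printing Implicit Defensive.
Import Order.TTheory GRing.Theory Num.Theory.
Import numFieldNormedType.Exports.
Local Open Scope classical_set_scope.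
Local Open Scope ring_scope.

(* A [tvsType R] is a locally convex topological vector space that is not
   required to be Hausdorff; Hausdorffness of the model spaces is part of
   [is_chart]. *)

Section Calculus.
Context {R : realType}.
Implicit Types X Y : tvsType R.

(* jet X n = (..((X * X) * X)..) * X = X * X^n, with elements
   (x, v_1, .., v_n) associated to the left; x is the base point. *)
Fixpoint jet X (n : nat) : tvsType R :=
  if n is m.+1 then (jet X m * X)%type else X.

Fixpoint jbase X (n : nat) : jet X n -> X :=
  match n with
  | 0%N => fun x => x
  | m.+1 => fun p => jbase p.1
  end.

(* (x, v_1, .., v_n) |-> (x + w, v_1, .., v_n) *)
Fixpoint jshift X (n : nat) : jet X n -> X -> jet X n :=
  match n with
  | 0%N => fun x w => x + w
  | m.+1 => fun p w => (jshift p.1 w, p.2)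
  end.

Definition dquot X Y n (g : jet X n -> Y) (p : jet X n.+1) : set_system Y :=
  h^-1 *: (g (jshift p.1 (h *: p.2)) - g p.1) @[h --> (0 : R)^'].

(* dn n f (x, v_1, .., v_n) = d^n f(x).(v_1, .., v_n), and 0 where the
   defining limit does not exist ([lim] is not available because [tvsType]
   is not a pointed type). *)
Fixpoint dn X Y (n : nat) (f : X -> Y) : jet X n -> Y :=
  match n with
  | 0%N => f
  | m.+1 => fun p => xget 0 [set l | dquot (dn (n := m) f) p --> l]
  end.

(* f is C^n on the open set V *)
Definition is_C X Y (n : nat) (V : set X) (f : X -> Y) : Prop :=
  (forall k, (k < n)%N -> forall p : jet X k.+1, V (jbase p) ->
     exists l : Y, dquot (dn (n := k) f) p --> l) /\
  (forall k, (k <= n)%N ->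
     {within [set p : jet X k | V (jbase p)], continuous (dn (n := k) f)}).

Definition smooth_open X Y (V : set X) (f : X -> Y) : Prop :=
  forall n, is_C n V f.

(* Smoothness on a domain A with dense interior. *)
Definition smooth_dom X Y (A : set X) (f : X -> Y) : Prop :=
  [/\ {within A, continuous f},
      smooth_open A° f &
      forall n, exists g : jet X n -> Y,
        {within [set p : jet X n | A (jbase p)], continuous g} /\
        (forall p, A° (jbase p) -> g p = dn f p)].

(* Smoothness on an arbitrary subset A of R^m, by local extension. *)
Definition smooth_ext m k (A : set 'rV[R]_m) (f : 'rV[R]_m -> 'rV[R]_k) : Prop :=
  forall x, A x -> exists (U : set 'rV[R]_m) (g : 'rV[R]_m -> 'rV[R]_k),
    [/\ open U, U x, smooth_open U g & forall y, A y -> U y -> g y = f y].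

End Calculus.

Section Manifolds.
Context {R : realType}.
Implicit Types (S T : topologicalType) (X Y : tvsType R).

(* A homeomorphism from [cdom] onto its image in X, both directions being
   totalised: the values of [cfun] outside [cdom] and those of [cinv] outside
   [cfun @` cdom] are irrelevant. *)
Record chart T X := Chart { cdom : set T; cfun : T -> X; cinv : X -> T }.

(* c is a homeomorphism from an open subset of T onto a relatively open subset
   of C *)
Definition is_chart T X (C : set X) (c : chart T X) : Prop :=
  [/\ hausdorff_space X, open (cdom c),
      {within cdom c, continuous (cfun c)} /\
        {within cfun c @` cdom c, continuous (cinv c)},
      (forall x, cdom c x -> cinv c (cfun c x) = x) &
      exists2 W : set X, open W & cfun c @` cdom c = C `&` W].

(* Charts into possibly different locally convex spaces. *)
Definition atlas T := forall X : tvsType R, set (chart T X).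

Definition atlas_covers T (A : atlas T) : Prop :=
  forall x, exists X (c : chart T X), A _ c /\ cdom c x.

Definition compatible T (A : atlas T) : Prop :=
  forall X (c : chart T X) Y (c' : chart T Y),
    A _ c -> A _ c' ->
    smooth_dom (cfun c @` (cdom c `&` cdom c')) (cfun c' \o cinv c).

(* {x | lam_i x >= 0 for all i} for finitely many (possibly no) linearly
   independent continuous functionals lam_i *)
Definition is_quadrant X (C : set X) : Prop :=
  exists (k : nat) (lam : 'I_k -> {linear X -> R^o}),
  [/\ forall i, continuous (lam i),
      forall a : 'I_k -> R,
        (forall x, \sum_i a i * lam i x = 0) -> forall i, a i = 0 &
      C = [set x | forall i, 0 <= lam i x]].

Definition lc_manifold T (A : atlas T) : Prop :=
  [/\ hausdorff_space T,
      forall X (c : chart T X), A _ c -> is_chart setT c,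
      atlas_covers A & compatible A].

Definition lc_manifold_corners T (A : atlas T) : Prop :=
  [/\ hausdorff_space T,
      forall X (c : chart T X), A _ c ->
        exists2 C : set X, is_quadrant C & is_chart C c,
      atlas_covers A & compatible A].

Definition paracompact T : Prop :=
  forall U : set (set T), U `<=` open -> \bigcup_(B in U) B = setT ->
  exists V : set (set T),
    [/\ V `<=` open, \bigcup_(B in V) B = setT,
        forall B, V B -> exists2 B', U B' & B `<=` B' &
        forall x : T, exists2 W, nbhs x W &
          finite_set [set B | V B /\ B `&` W !=set0]].

Definition orthant (d : nat) : set 'rV[R]_d := [set x | forall i, 0 <= x ord0 i].

Definition fd_manifold_corners (d : nat) T (A : set (chart T 'rV[R]_d)) : Prop :=
  [/\ hausdorff_space T, paracompact T,
      forall c, A c -> is_chart (@orthant d) c,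
      forall x, exists2 c, A c & cdom c x &
      forall c c', A c -> A c' ->
        smooth_ext (cfun c @` (cdom c `&` cdom c')) (cfun c' \o cinv c)].

Inductive fd_atlas (d : nat) T (A : set (chart T 'rV[R]_d)) : atlas T :=
  FdAtlas c of A c : fd_atlas A c.

Definition prod_chart S T X Y (c : chart S X) (c' : chart T Y) :
    chart (S * T)%type (X * Y)%type :=
  Chart (cdom c `*` cdom c')
    (fun z => (cfun c z.1, cfun c' z.2))
    (fun z => (cinv c z.1, cinv c' z.2)).

Inductive prod_atlas S T (A : atlas S) (B : atlas T) : atlas (S * T)%type :=
  ProdAtlas X (c : chart S X) Y (c' : chart T Y) of A X c & B Y c' :
    prod_atlas A B (prod_chart c c').

(* f is smooth on the open subset W of S, in charts *)
Definition smooth_on S T (A : atlas S) (B : atlas T) (W : set S) (f : S -> T) :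
    Prop :=
  {within W, continuous f} /\
  forall X (c : chart S X) Y (c' : chart T Y),
    A _ c -> B _ c' ->
    smooth_dom (cfun c @` (W `&` cdom c `&` f @^-1` cdom c'))
      (cfun c' \o f \o cinv c).

Definition smooth_near S T (A : atlas S) (B : atlas T) (L : set S) (f : S -> T) :
    Prop :=
  exists2 W : set S, open W /\ L `<=` W & smooth_on A B W f.

(* f : W -> W' is a diffeomorphism between open subsets, with inverse g *)
Definition diffeo_on S T (A : atlas S) (B : atlas T) (W : set S) (W' : set T)
    (f : S -> T) (g : T -> S) : Prop :=
  [/\ smooth_on A B W f, smooth_on B A W' g,
      forall x, W x -> W' (f x) /\ g (f x) = x &
      forall y, W' y -> W (g y) /\ f (g y) = y].

Definition locally_trivial (M N E : topologicalType)
    (AM : atlas M) (AN : atlas N) (AE : atlas E) (pi : E -> M) : Prop :=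
  smooth_on AE AM setT pi /\
  exists (I : Type) (U : I -> set M)
         (phi : I -> E -> M * N) (psi : I -> M * N -> E),
  [/\ forall t, open (U t),
      forall x, exists t, U t x,
      forall t, diffeo_on AE (prod_atlas AM AN)
                  (pi @^-1` U t) (U t `*` setT) (phi t) (psi t) &
      forall t e, U t (pi e) -> (phi t e).1 = pi e].

Definition is_section (M E : Type) (pi : E -> M) (sigma : M -> E) : Prop :=
  forall x, pi (sigma x) = x.

End Manifolds.

(* Main.v *)
(* In bundle charts a section is a map s from an open subset of an orthant of R^d
   to an open subset of a locally convex space Y. Near a compact set such a map
   is smoothed by replacing it successively by (1 - b) s + b y, for finitely
   many smooth bump functions b and nearby constants y: it becomes smooth where
   some b equals 1, stays smooth where it was, and stays in a prescribed open
   set provided that the constants are chosen in a convex neighbourhood, uniform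
   over the compact set. Multiplying the weights by a function of t that
   vanishes away from t = 1 extends such a modification to a homotopy F(t, x),
   without reparametrization. Take a locally finite cover of M by relatively
   compact open subsets of charts, shrunk to closed sets K B, and replace O by
   the smaller open set Om of those points of O that lie in the chosen bundle
   charts: the modifications over the various B then remain in the domains of
   all charts. Zorn's lemma applied to the homotopies that are smoothed over a
   part J of the cover yields the theorem, because chains of those are locally
   eventually constant.

   Smoothness in the sense of the jets [dn] is converted to the predicate [Cn],
   for which the chain rule is an induction on n. The chain rule for domains with
   boundary needs maps that send interior points to interior points; for
   changes of charts this is [diffeo_interior]. *)
Require Import Defs.
From HB Require Import structures.
From mathcomp Require Import all_boot all_order all_algebra.
From mathcomp Require Import all_classical all_reals all_analysis.
From mathcomp Require Import lra ring.
Set Implicit Arguments.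
Unset Strict Implicit.
Unset Printing Implicit Defensive.
Import Order.TTheory GRing.Theory Num.Theory.
Import numFieldNormedType.Exports.
Local Open Scope classical_set_scope.
Local Open Scope ring_scope.

(** * Difference quotients and the mean value theorem *)

Section Convex.
Context {R : realType}.
Implicit Types X Y Z : tvsType R.

(** The model spaces carry no norm, so every estimate takes the form of membership in a convex open
    set: the mean value theorem puts an increment into any such set containing the derivatives, and
    [quot_cvg] deduces limits of difference quotients whose base point, direction and step all vary.
    A chain rule for the differential of order n, a function of n directions, would be a sum over
    partitions; [Cn] instead regards the derivative as a map on a product space and differentiates
    it again in all its variables. The price is the passage from [dn] to [Cn]: differentiating d^k f
    also in its direction slots rests on its multilinearity, which must be proved. At boundary
    points a derivative is only a continuous extension, so identities between derivatives are shown
    at interior points and extended by density. Homotopies are defined for all real times and are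
    constant for t >= 1; a step alters them only for t > 1 - e, where e depends on the step. Only
    finitely many steps affect a neighbourhood of a given point, so no common e is required. *)

Definition convex_subset Y (C : set Y) :=
  forall a b (t : R), C a -> C b -> 0 <= t <= 1 -> C ((1 - t) *: a + t *: b).

Lemma nbhs_convex Y (y : Y) (U : set Y) : nbhs y U ->
  exists C : set Y, [/\ open C, C y, C `<=` U & convex_subset C].
Proof.
move=> Uy; have [B Bc [Bo Bb]] := @locally_convex R Y.
have [C [BC Cy] CU] := Bb y U Uy.
exists C; split => //; first exact: Bo.
move=> a b t Ca Cb /andP[t0 t1].
have := Bc C (mem_set BC) b a (Itv01 t0 t1) (mem_set Cb) (mem_set Ca).
by rewrite inE; congr (C _); rewrite addrC.
Qed.

Lemma nbhs_setX (S T : topologicalType) (a : S) (b : T) A B :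
  nbhs a A -> nbhs b B -> nbhs (a, b) (A `*` B).
Proof. by move=> nA nB; exists (A, B). Qed.

Lemma hausdorff_setX (S T : topologicalType) :
  hausdorff_space S -> hausdorff_space T -> hausdorff_space (S * T)%type.
Proof.
move=> hS hT [a b] [c d] H; congr pair.
- apply: hS => A B nA nB.
  have [||[x y] [[Ax _] [Bx _]]] := H (A `*` setT) (B `*` setT).
  + by apply: nbhs_setX => //; exact: filterT.
  + by apply: nbhs_setX => //; exact: filterT.
  + by exists x.
- apply: hT => A B nA nB.
  have [||[x y] [[_ Ay] [_ By]]] := H (setT `*` A) (setT `*` B).
  + by apply: nbhs_setX => //; exact: filterT.
  + by apply: nbhs_setX => //; exact: filterT.
  + by exists y.
Qed.

Lemma interior_setX (S T : topologicalType) (A : set S) :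
  (A `*` [set: T])° = A° `*` [set: T].
Proof.
apply/seteqP; split => [[x y]|[x y] [Ax _]].
  move=> [[P Q] /= [nP nQ] PQ]; split => //=.
  apply: filterS nP => z Pz.
  by have [] := PQ (z, y) (conj Pz (nbhs_singleton nQ)).
by apply: nbhs_setX => //; exact: filterT.
Qed.

(** A relation rather than a function: existence and value are asserted together, and uniqueness is
    invoked only for Hausdorff targets. *)
Definition dirder X Y (f : X -> Y) (x v : X) (l : Y) :=
  h^-1 *: (f (x + h *: v) - f x) @[h --> (0 : R)^'] --> l.

Definition cderiv Y (g : R -> Y) (t : R) (l : Y) :=
  h^-1 *: (g (t + h) - g t) @[h --> (0 : R)^'] --> l.

Lemma dirder_unique X Y (f : X -> Y) x v l l' : hausdorff_space Y ->
  dirder f x v l -> dirder f x v l' -> l = l'.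
Proof. by move=> hY; apply: cvg_unique. Qed.

(* Sup argument: the difference quotients over [u, t] and [t, v] lie in [C] for
   [u <= t <= v] close to [t], and quotients over adjacent intervals combine
   convexly. *)
Lemma mean_value Y (C : set Y) (g : R -> Y) : open C -> convex_subset C ->
  (forall t, 0 <= t <= 1 -> exists2 l, C l & cderiv g t l) -> C (g 1 - g 0).
Proof.
move=> oC cC dg.
(* The alternative [u = v] makes [Q] reflexive, so that 0 belongs to [S] below although 0 need not
   lie in [C]. *)
pose Q u v := u = v \/ C ((v - u)^-1 *: (g v - g u)).
have Qtrans u v w : u <= v -> v <= w -> Q u v -> Q v w -> Q u w.
  move=> uv vw [->//|Cuv] [<-|Cvw]; first by right.
  have [uve|uv1] := eqVneq u v; first by rewrite uve; right.
  have [vwe|vw1] := eqVneq v w; first by rewrite -vwe; right.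
  right; have u_v : u < v by rewrite lt_neqAle uv1.
  have v_w : v < w by rewrite lt_neqAle vw1.
  have := cC _ _ ((w - v) / (w - u)) Cuv Cvw.
  have -> : 1 - (w - v) / (w - u) = (v - u) / (w - u).
    by field; rewrite subr_eq0 gt_eqF//; apply: lt_trans v_w.
  rewrite !scalerA.
  rewrite ![_ / (w - u) * _]mulrAC mulfV ?mul1r; last by rewrite subr_eq0 gt_eqF.
  rewrite mulfV ?mul1r; last by rewrite subr_eq0 gt_eqF.
  have -> : g w - g u = (g v - g u) + (g w - g v).
    by rewrite [RHS]addrC addrA subrK.
  move=> H; rewrite scalerDr; apply: H.
  rewrite divr_ge0 ?subr_ge0//= ?ler_pdivrMr ?mul1r ?subr_gt0; try lra.
have straddle t : 0 <= t <= 1 -> exists2 e : R, 0 < e &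
    forall u v, u <= t -> t <= v -> t - e < u -> v < t + e -> Q u v.
  move=> /dg[l Cl dl].
  have [e e0 He] := dl _ (open_nbhs_nbhs (conj oC Cl)).
  exists e => // u v ut tv teu vte; apply: (Qtrans _ t) => //.
    have [->|utn] := eqVneq u t; first by left.
    right; have := He (u - t); rewrite /= sub0r normrN.
    rewrite [t + _]addrC subrK subr_eq0 => /(_ _ utn).
    rewrite -[u - t]opprB -[g u - g t]opprB invrN scaleNr scalerN opprK; apply.
    by rewrite normrN ger0_norm ?subr_ge0//; lra.
  have [->|vtn] := eqVneq t v; first by left.
  right; have := He (v - t); rewrite /= sub0r normrN.
  rewrite [t + _]addrC subrK subr_eq0 eq_sym => /(_ _ vtn); apply.
  by rewrite ger0_norm ?subr_ge0//; lra.
pose S := [set t : R | 0 <= t <= 1 /\ Q 0 t].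
have S0 : S 0 by split; [rewrite lexx ler01|left].
have hS : has_sup S by split; [exists 0|exists 1 => x [/andP[]]].
have c0 : 0 <= sup S by exact: sup_upper_bound.
have c1 : sup S <= 1 by apply: ge_sup; [exists 0|move=> x [/andP[]]].
have [|e e0 He] := straddle (sup S); first by rewrite c0.
have [s [/andP[s0 s1] Q0s] es] := sup_adherent e0 hS.
have sc : s <= sup S by apply: sup_upper_bound => //; split => //; rewrite s0.
have Qc v : sup S <= v -> v < sup S + e -> Q 0 v.
  by move=> cv ve; apply: (Qtrans _ s) => //; [exact: le_trans cv|exact: He].
have [c1'|c1'] := ltP (sup S) 1.
  have S' : S (Num.min 1 (sup S + e / 2)).
    split; first by rewrite ge_min lexx le_min ler01 /=; lra.
    by apply: Qc; rewrite ?le_min ?gt_min; [apply/andP; split|apply/orP; right]; lra.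
  have := sup_upper_bound hS S'; rewrite ge_min => /orP[|]; lra.
have [||/eqP|] := Qc 1; rewrite ?subr0 ?invr1 ?scale1r//; first by lra.
by rewrite eq_sym oner_eq0.
Qed.

End Convex.

Section Calc.
Context {R : realType}.
Implicit Types X Y Z : tvsType R.

Lemma tcvgD Y (I : Type) (F : set_system I) (FF : Filter F) (f g : I -> Y) (a b : Y) :
  f i @[i --> F] --> a -> g i @[i --> F] --> b -> f i + g i @[i --> F] --> a + b.
Proof.
move=> fa gb.
apply: (@cvg_comp _ _ _ (fun i => (f i, g i)) (fun p => p.1 + p.2) _ (nbhs (a, b))).
  exact: cvg_pair.
exact: (@add_continuous Y (a, b)).
Qed.

Lemma tcvgZ Y (I : Type) (F : set_system I) (FF : Filter F)
    (r : I -> R) (f : I -> Y) (c : R) (a : Y) :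
  r i @[i --> F] --> c -> f i @[i --> F] --> a -> r i *: f i @[i --> F] --> c *: a.
Proof.
move=> rc fa.
apply: (@cvg_comp _ _ _ (fun i => (r i : R^o, f i)) (fun p => p.1 *: p.2) _
  (nbhs (c : R^o, a))).
  exact: (@cvg_pair _ _ _ F (nbhs (c : R^o)) (nbhs a) _ _ _ r f rc fa).
exact: (@scale_continuous R Y (c : R^o, a)).
Qed.

Lemma tcvgB Y (I : Type) (F : set_system I) (FF : Filter F) (f g : I -> Y) (a b : Y) :
  f i @[i --> F] --> a -> g i @[i --> F] --> b -> f i - g i @[i --> F] --> a - b.
Proof.
move=> fa gb; apply: tcvgD => //.
by apply: continuous_cvg gb; exact: (@opp_continuous Y).
Qed.

Lemma mul_dnbhs0 (c : R) : c != 0 -> h * c @[h --> (0 : R)^'] --> (0 : R)^'.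
Proof.
move=> c0.
have := @continuous_injective_withinNx R R (fun h => h * c) 0.
rewrite mul0r; apply; first exact: mulrr_continuous.
by move=> y /eqP; rewrite mulf_eq0 (negPf c0) orbF => /eqP.
Qed.

(** The factor [c^-1] cancels the speed of the curve. The derivative is then [l] itself, and the
    increment from time 0 to time 1 is a difference quotient of step [c]. *)
Lemma dirder_cderiv X Y (G : X -> Y) (y w : X) (s c : R) l : c != 0 ->
  dirder G (y + (s * c) *: w) w l ->
  cderiv (fun t => c^-1 *: G (y + (t * c) *: w)) s l.
Proof.
move=> c0 dG; rewrite /cderiv.
rewrite (_ : (fun h => _) = (fun k => k^-1 *: (G (y + (s * c) *: w + k *: w) -
   G (y + (s * c) *: w))) \o (fun h => h * c)).
  by apply: cvg_comp; [exact: mul_dnbhs0 c0|exact: dG].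
apply/funext => h /=; rewrite -scalerBr scalerA invfM; congr (_ *: (G _ - _)).
by rewrite -addrA -scalerDl -mulrDl.
Qed.

(** Along the segment from [z i] to [z i + h i *: iota (v i)] all derivatives lie in one convex open
    neighbourhood of the limit, hence by [mean_value] so does the quotient. This one statement
    serves the chain rule, the linearity of differentials and the differentiation of functions on
    jets; [iota] admits directions from a space other than that of the base points. *)
Lemma quot_cvg (I : Type) (F : set_system I) (FF : Filter F) X Z Y (iota : X -> Z)
    (G : Z -> Y) (D : Z * X -> Y) (z : I -> Z) (v : I -> X) (h : I -> R) (z0 : Z) (v0 : X) :
  (forall c w, iota (c *: w) = c *: iota w) -> continuous iota ->
  (\forall y \near z0, forall w, dirder G y (iota w) (D (y, w))) ->
  D p @[p --> (z0, v0)] --> D (z0, v0) ->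
  z i @[i --> F] --> z0 -> v i @[i --> F] --> v0 -> h i @[i --> F] --> (0 : R) ->
  (\forall i \near F, h i != 0) ->
  (h i)^-1 *: (G (z i + h i *: iota (v i)) - G (z i)) @[i --> F] --> D (z0, v0).
Proof.
move=> iZ ic dG Dc zc vc hc hn0 U /nbhs_convex[C [oC Cl CU cC]].
have NC : nbhs (z0, v0) [set p | C (D p) /\ forall w, dirder G p.1 (iota w) (D (p.1, w))].
  apply: filterI; first exact: Dc (open_nbhs_nbhs (conj oC Cl)).
  exact: (@cvg_fst _ _ (nbhs z0) (nbhs v0) _ _ dG).
(* Continuity of [m] at (z0, (0, v0)) controls the whole segment and not only its endpoint: with
   [h i] in a ball around 0, so are all [t * h i] for t in [0, 1]. *)
pose m (q : Z * (R * X)) := (q.1 + q.2.1 *: iota q.2.2, q.2.2).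
have mc : m q @[q --> (z0, ((0 : R), v0))] --> (z0, v0).
  apply: cvg_pair => /=; last by apply: cvg_comp; [exact: cvg_snd|exact: cvg_snd].
  suff : q.1 + q.2.1 *: iota q.2.2 @[q --> (z0, ((0 : R), v0))] -->
      z0 + (0 : R) *: iota v0 by rewrite scale0r addr0.
    apply: tcvgD; first exact: cvg_fst.
    apply: tcvgZ; first by apply: cvg_comp; [exact: cvg_snd|exact: cvg_fst].
    apply: continuous_cvg; first exact: ic.
    by apply: cvg_comp; [exact: cvg_snd|exact: cvg_snd].
have [[A B] /= [nA [[B1 B2] /= [nB1 nB2]] BB] AB] := mc _ NC.
have [e /= e0 Be] := nB1.
have nh : F [set i | ball (0 : R) e (h i)] := hc _ (nbhsx_ballx (0 : R) e e0).
have nz : F [set i | A (z i)] := zc _ nA.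
have nv : F [set i | B2 (v i)] := vc _ nB2.
apply: filterS (filterI (filterI nz nv) (filterI nh hn0)).
move=> i [[/= zi vi] [/= hi hi0]]; apply: CU.
pose g t := (h i)^-1 *: G (z i + (t * h i) *: iota (v i)).
rewrite scalerBr.
rewrite (_ : _ *: G _ - _ *: G _ = g 1 - g 0); last first.
  by rewrite /g mul0r scale0r addr0 mul1r.
apply: mean_value => // t /andP[t0 t1].
have /= [Cp dp] : [set p | C (D p) /\ forall w, dirder G p.1 (iota w) (D (p.1, w))]
    (m (z i, (t * h i, v i))).
  apply: AB; split => //=; apply: BB; split => //=; apply: Be.
  move: hi; rewrite /ball/= !sub0r !normrN normrM ger0_norm//.
  by apply: le_lt_trans; rewrite ler_piMl.
exists (D (z i + (t * h i) *: iota (v i), v i)) => //.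
by apply: dirder_cderiv => //.
Qed.

End Calc.

(** * Maps of class C^n on a set *)

Section Cts.
Implicit Types S T U : topologicalType.

Definition cts S T (A : set S) (f : S -> T) :=
  forall x, A x -> f y @[y --> within A (nbhs x)] --> f x.

Lemma ctsP S T (A : set S) (f : S -> T) : {within A, continuous f} <-> cts A f.
Proof. exact: subspace_continuousP. Qed.

Lemma continuous_cts S T (A : set S) (f : S -> T) : continuous f -> cts A f.
Proof. by move=> fc x _; apply: cvg_within_filter; exact: fc. Qed.

Lemma cts_interior S T (A : set S) (f : S -> T) x : cts A f -> A° x ->
  f y @[y --> x] --> f x.
Proof.
move=> fc Ax U Uf; have := fc x (interior_subset Ax) U Uf.
by apply: filterS2 Ax => y Ay /=; exact.
Qed.

Lemma cts_sub S T (A B : set S) (f : S -> T) : B `<=` A -> cts A f -> cts B f.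
Proof.
move=> BA fc x /BA Ax U /(fc x Ax); rewrite /nbhs/= /within/=.
by apply: filterS => y H /BA.
Qed.

Lemma cts_eq S T (A : set S) (f g : S -> T) : (forall x, A x -> f x = g x) ->
  cts A f -> cts A g.
Proof.
move=> fg fc x Ax U; rewrite -fg// => /(fc x Ax); rewrite /nbhs/= /within/=.
by apply: filterS => y H Ay; rewrite -fg//; exact: H.
Qed.

Lemma cts_comp S T U (A : set S) (B : set T) (f : S -> T) (g : T -> U) :
  (forall x, A x -> B (f x)) -> cts A f -> cts B g -> cts A (g \o f).
Proof.
move=> AB fc gc x Ax V /(gc _ (AB _ Ax)) /(fc x Ax); rewrite /nbhs/= /within/=.
by apply: filterS => y H Ay; apply: H => //; exact: AB.
Qed.

Lemma cts_pair S T U (A : set S) (f : S -> T) (g : S -> U) :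
  cts A f -> cts A g -> cts A (fun x => (f x, g x)).
Proof. by move=> fc gc x Ax; apply: cvg_pair; [exact: fc|exact: gc]. Qed.

Lemma continuous_fst S T : continuous (fst : (S * T)%type -> S).
Proof. by move=> p; exact: cvg_fst. Qed.

Lemma continuous_snd S T : continuous (snd : (S * T)%type -> T).
Proof. by move=> p; exact: cvg_snd. Qed.

Lemma cts_local S T (A : set S) (f : S -> T) :
  (forall x, A x -> exists2 W, nbhs x W & cts (A `&` W) f) -> cts A f.
Proof.
move=> H x Ax; have [W nW fc] := H x Ax => U Uf.
have := fc x (conj Ax (nbhs_singleton nW)) U Uf; rewrite /nbhs/= /within/=.
by apply: filterS2 nW => y Wy K Ay; exact: K.
Qed.

End Cts.

Section CnDef.
Context {R : realType}.
Implicit Types X Y Z : tvsType R.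

(* The derivative [f'] lives on the whole of [A `*` setT]: it is the continuous
   extension of the differential from the interior of [A], and so on for the
   higher differentials. *)
Fixpoint Cn n Y : forall X : tvsType R, set X -> (X -> Y) -> Prop :=
  match n with
  | 0%N => fun X A f => cts A f
  | m.+1 => fun X A f => cts A f /\ exists f' : (X * X)%type -> Y,
      (forall x v, A° x -> dirder f x v (f' (x, v))) /\
      @Cn m Y (X * X)%type (A `*` setT) f'
  end.

Lemma Cn_cts n X Y (A : set X) (f : X -> Y) : Cn n A f -> cts A f.
Proof. by case: n => //= n []. Qed.

Lemma CnW n X Y (A : set X) (f : X -> Y) : Cn n.+1 A f -> Cn n A f.
Proof.
elim: n X A f => [X A f []//|n IH X A f [fc [f' [df Sf]]]].
by split => //; exists f'; split => //; exact: IH.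
Qed.

Lemma dirder_near X Y (f g : X -> Y) x v l :
  (\forall y \near x, f y = g y) -> dirder f x v l -> dirder g x v l.
Proof.
move=> fg; apply: cvg_trans; apply: near_eq_cvg.
have xc : x + h *: v @[h --> (0 : R)] --> x.
  suff : x + h *: v @[h --> (0 : R)] --> x + (0 : R) *: v by rewrite scale0r addr0.
  apply: tcvgD; first exact: cvg_cst.
  by apply: tcvgZ; [exact: cvg_id|exact: cvg_cst].
have fgx := nbhs_singleton fg.
near=> h; rewrite fgx; congr (_ *: (_ - _)).
by near: h; exact: nbhs_dnbhs (xc _ fg).
Unshelve. all: by end_near. Qed.

Lemma Cn_eq n X Y (A : set X) (f g : X -> Y) : (forall x, A x -> f x = g x) ->
  Cn n A f -> Cn n A g.
Proof.
case: n => [|n] fg /=; first exact: cts_eq.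
move=> [fc [f' [df Sf]]]; split; first exact: cts_eq fc.
exists f'; split => // x v Ax; apply: dirder_near (df x v Ax).
by apply: filterS Ax.
Qed.

Lemma Cn_sub n X Y (A B : set X) (f : X -> Y) : B `<=` A -> Cn n A f -> Cn n B f.
Proof.
elim: n X A B f => [|n IH] X A B f BA /=; first exact: cts_sub.
move=> [fc [f' [df Sf]]]; split; first exact: cts_sub fc.
exists f'; split; last by apply: IH Sf => -[x v] [/BA].
by move=> x v Bx; apply: df; exact: interiorS Bx.
Qed.

Lemma Cn_pair n X Y Z (A : set X) (f : X -> Y) (g : X -> Z) :
  Cn n A f -> Cn n A g -> Cn n A (fun x => (f x, g x)).
Proof.
elim: n X A f g => [|n IH] X A f g /=; first exact: cts_pair.
move=> [fc [f' [df Sf]]] [gc [g' [dg Sg]]]; split; first exact: cts_pair.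
exists (fun p => (f' p, g' p)); split; last exact: IH.
move=> x v Ax; exact: (@cvg_pair _ _ _ _ _ _ _ _ _ _ _ (df x v Ax) (dg x v Ax)).
Qed.

Definition lin X Y (f : X -> Y) :=
  (forall x y, f (x + y) = f x + f y) /\ (forall (c : R) x, f (c *: x) = c *: f x).

(** The derivative [f \o snd] is again linear and continuous, so the induction closes. *)
Lemma Cn_lin n X Y (A : set X) (f : X -> Y) : lin f -> continuous f -> Cn n A f.
Proof.
elim: n X A f => [|n IH] X A f [fD fZ] fc /=; first exact: continuous_cts.
split; first exact: continuous_cts.
exists (fun p => f p.2); split; last first.
  apply: IH; first by split => [x y|c x] /=; rewrite ?fD ?fZ.
  by move=> p; apply: (@continuous_comp _ _ _ snd f); [exact: cvg_snd|exact: fc].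
move=> x v _; apply: cvg_near_cst; near=> h.
have h0 : h != 0 by near: h; exact: nbhs_dnbhs_neq.
by rewrite fD addrC addKr fZ scalerA mulVf// scale1r.
Unshelve. all: by end_near. Qed.

Lemma Cn_cst n X Y (A : set X) (c : Y) : Cn n A (fun _ : X => c).
Proof.
elim: n X A c => [|n IH] X A c /=; first by apply: continuous_cts => x; exact: cvg_cst.
split; first by apply: continuous_cts => x; exact: cvg_cst.
exists (fun=> 0); split; last exact: IH.
by move=> x v _; apply: cvg_near_cst; near=> h; rewrite subrr scaler0.
Unshelve. all: by end_near. Qed.

(** With [q] the difference quotient of [f], one has f(x + hv) = f(x) + h q(h). This is [quot_cvg]
    for [g] at the fixed base point [f x] and the moving direction [q h]. *)
Lemma dirder_comp X Y Z (f : X -> Y) (g : Y -> Z) (D : (Y * Y)%type -> Z) x v l :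
  dirder f x v l -> (\forall y \near f x, forall w, dirder g y w (D (y, w))) ->
  D p @[p --> (f x, l)] --> D (f x, l) ->
  dirder (g \o f) x v (D (f x, l)).
Proof.
move=> df dg Dc; pose q h := h^-1 *: (f (x + h *: v) - f x).
apply: cvg_trans (@quot_cvg _ _ ((0 : R)^') _ Y Y Z idfun g D (fun=> f x) q id
  (f x) l _ _ dg Dc _ _ _ _).
- apply: near_eq_cvg; near=> h.
  have h0 : h != 0 by near: h; exact: nbhs_dnbhs_neq.
  by rewrite /q /= scalerA divff// scale1r [f x + _]addrC subrK.
- by [].
- by move=> y; exact: cvg_id.
- exact: cvg_cst.
- exact: df.
- exact: nbhs_dnbhs.
- exact: nbhs_dnbhs_neq.
Unshelve. all: by end_near. Qed.

(** The derivative of the composite sends (x, v) to g'(f x, f'(x, v)). It is again a composite, of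
    one order less, and the induction hypothesis is used a second time for its inner component
    [f \o fst]. *)
Lemma Cn_comp n X Y Z (A : set X) (B : set Y) (f : X -> Y) (g : Y -> Z) :
  (forall x, A x -> B (f x)) -> (forall x, A° x -> B° (f x)) ->
  Cn n A f -> Cn n B g -> Cn n A (g \o f).
Proof.
elim: n X Y Z A B f g => [|n IH] X Y Z A B f g AB ABi; first exact: cts_comp.
move=> Sf [gc [g' [dg Sg]]]; have Sf' := CnW Sf.
move: Sf => [fc [f' [df Sdf]]]; split; first exact: cts_comp gc.
exists (g' \o (fun p => (f p.1, f' p))); split.
  move=> x v Ax; apply: dirder_comp; first exact: df.
    by apply: filterS (open_nbhs_nbhs (conj (open_interior B) (ABi x Ax))) => y By w;
      exact: dg.
  by apply: cts_interior (Cn_cts Sg) _; rewrite interior_setX; split => //; exact: ABi.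
apply: (IH _ _ _ _ (B `*` setT)) => //.
- by move=> [x v] [/= Ax _]; split => //; exact: AB.
- by move=> [x v]; rewrite !interior_setX => -[/= Ax _]; split => //; exact: ABi.
- apply: Cn_pair => //; apply: (@IH _ _ _ _ A fst f) => //.
  + by move=> p [].
  + by move=> p; rewrite interior_setX => -[].
  + by apply: Cn_lin => // p; exact: cvg_fst.
Qed.

Lemma Cn_compT n X Y Z (A : set X) (f : X -> Y) (g : Y -> Z) :
  Cn n A f -> Cn n setT g -> Cn n A (g \o f).
Proof. by apply: Cn_comp => // x _; rewrite interiorT. Qed.

Lemma Cn_add n X Y (A : set X) (f g : X -> Y) :
  Cn n A f -> Cn n A g -> Cn n A (fun x => f x + g x).
Proof.
move=> Sf Sg; apply: (@Cn_compT n X (Y * Y)%type Y A (fun x => (f x, g x))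
  (fun p => p.1 + p.2)); first exact: Cn_pair.
apply: Cn_lin; last exact: add_continuous.
split => [x y|c x] /=; first by rewrite addrACA.
by rewrite scalerDr.
Qed.

Lemma Cn_scal n Y : Cn n [set: (R^o * Y)%type] (fun p => p.1 *: p.2).
Proof.
elim: n Y => [|n IH] Y /=; first by apply: continuous_cts; exact: scale_continuous.
split; first by apply: continuous_cts; exact: scale_continuous.
exists (fun p => p.1.1 *: p.2.2 + p.2.1 *: p.1.2); split.
  move=> [r y] [s z] _ /=.
  (* For a bilinear map the difference quotient is the derivative plus the remainder
     [h *: (s *: z)]. *)
  suff : (r *: z + s *: y) + h *: (s *: z) @[h --> (0 : R)^'] -->
      (r *: z + s *: y) + (0 : R) *: (s *: z).
    rewrite scale0r addr0; apply: cvg_trans; apply: near_eq_cvg; near=> h => /=.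
    have h0 : h != 0 by near: h; exact: nbhs_dnbhs_neq.
    apply: (@scalerI _ _ h) => //; rewrite [RHS]scalerA divff// scale1r.
    rewrite scalerDl !scalerDr !scalerA (_ : h *: s = h * s)//.
    rewrite -!addrA [X in _ = X]addrC -!addrA addNr addr0.
    by rewrite [r * h]mulrC [h * s * h]mulrC.
  apply: tcvgD; first exact: cvg_cst.
  by apply: tcvgZ; [exact: nbhs_dnbhs|exact: cvg_cst].
rewrite setXTT.
apply: Cn_add.
  apply: (@Cn_compT n ((R^o * Y) * (R^o * Y))%type (R^o * Y)%type Y setT
    (fun p => (p.1.1, p.2.2)) (fun p => p.1 *: p.2)) => //.
  apply: Cn_pair; apply: Cn_lin => // p; apply: continuous_comp;
  solve [exact: continuous_fst|exact: continuous_snd].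
apply: (@Cn_compT n ((R^o * Y) * (R^o * Y))%type (R^o * Y)%type Y setT
    (fun p => (p.2.1, p.1.2)) (fun p => p.1 *: p.2)) => //.
apply: Cn_pair; apply: Cn_lin => // p; apply: continuous_comp;
  solve [exact: continuous_fst|exact: continuous_snd].
Unshelve. all: by end_near. Qed.

Lemma Cn_scale n X Y (A : set X) (r : X -> R^o) (f : X -> Y) :
  Cn n A r -> Cn n A f -> Cn n A (fun x => r x *: f x).
Proof.
move=> Sr Sf; apply: (@Cn_compT n X (R^o * Y)%type Y A (fun x => (r x, f x))
  (fun p => p.1 *: p.2)); [exact: Cn_pair|exact: Cn_scal].
Qed.

End CnDef.

(** * Localization, by density of the interior *)

Section Local.
Implicit Types S T : topologicalType.

Lemma cts_closure_eq S T (A D : set S) (f g : S -> T) x : hausdorff_space T ->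
  cts A f -> cts A g -> D `<=` A -> (forall y, D y -> f y = g y) ->
  A x -> closure D x -> f x = g x.
Proof.
move=> hT fc gc DA fg Ax cDx; apply: hT => U V Uf Vg.
have := fc x Ax U Uf; have := gc x Ax V Vg; rewrite /nbhs/= /within/= => nV nU.
have [y [Dy [Vy Uy]]] := cDx _ (filterI nV nU).
by exists (f y); split; [exact/Uy/DA|rewrite fg//; exact/Vy/DA].
Qed.

Lemma open_setX S T (A : set S) (B : set T) : open A -> open B -> open (A `*` B).
Proof.
move=> oA oB; rewrite openE => -[x y] [/= Ax By].
by apply: nbhs_setX; exact: open_nbhs_nbhs.
Qed.

Definition dense_interior S (A : set S) := A `<=` closure A°.

Lemma dense_interiorI S (A W : set S) : dense_interior A -> open W ->
  dense_interior (A `&` W).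
Proof.
move=> dA oW x [Ax Wx] N nN.
have [y [Ay [Ny Wy]]] := dA x Ax _ (filterI nN (open_nbhs_nbhs (conj oW Wx))).
exists y; split => //; rewrite interiorI; split => //.
by move: oW => /interior_id ->.
Qed.

Lemma dense_interiorX S T (A : set S) : dense_interior A ->
  dense_interior (A `*` [set: T]).
Proof.
move=> dA [x y] [/= Ax _] N [[P Q] /= [nP nQ] PQN].
have [z [Az Pz]] := dA x Ax _ nP.
exists (z, y); rewrite interior_setX; split => //.
by apply: PQN; split => //=; exact: nbhs_singleton.
Qed.

End Local.

Section CnLocal.
Context {R : realType}.
Implicit Types X Y Z : tvsType R.

(** The local derivatives are glued by using at each point the one chosen there. Two of them agree
    where both are given: at interior points by uniqueness of limits, at the others because the
    interior is dense and both are continuous. *)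
Lemma Cn_local n X Y (A : set X) (f : X -> Y) : hausdorff_space Y ->
  dense_interior A ->
  (forall x, A x -> exists W, [/\ open W, W x & Cn n (A `&` W) f]) -> Cn n A f.
Proof.
move=> hY; elim: n X A f => [|n IH] X A f dA HA.
  apply: cts_local => x Ax; have [W [oW Wx fW]] := HA x Ax.
  by exists W => //; exact: open_nbhs_nbhs.
split.
  apply: cts_local => x Ax; have [W [oW Wx fW]] := HA x Ax.
  by exists W; [exact: open_nbhs_nbhs|exact: Cn_cts fW].
have /choice[h Hh] : forall x, exists p : set X * ((X * X)%type -> Y), A x ->
    [/\ open p.1, p.1 x,
       forall y v, (A `&` p.1)° y -> dirder f y v (p.2 (y, v)) &
       Cn n ((A `&` p.1) `*` setT) p.2].
  move=> x; have [Ax|nAx] := pselect (A x); last by exists (setT, (fun=> 0)).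
  have [W [oW Wx [_ [f' [df Sf]]]]] := HA x Ax.
  by exists (W, f').
exists (fun p => (h p.1).2 p); split.
  move=> x v Ax; have [oW Wx dx _] := Hh x (interior_subset Ax).
  apply: dx; rewrite interiorI; split => //.
  by move: oW => /interior_id ->.
have agree x z v : A x -> A z -> (h x).1 z -> (h z).2 (z, v) = (h x).2 (z, v).
  move=> Ax Az xz.
  have [oWx Wx dx Sx] := Hh x Ax; have [oWz Wz dz Sz] := Hh z Az.
  pose B := A `&` ((h x).1 `&` (h z).1).
  have dB : dense_interior B by apply: dense_interiorI => //; exact: openI.
  have ctsB (k : (X * X)%type -> Y) C : B `<=` C -> Cn n (C `*` setT) k ->
      cts B (fun y => k (y, v)).
    move=> BC Sk; apply: (@cts_comp _ _ _ _ (C `*` setT) (fun y => (y, v)) k).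
    - by move=> y /BC.
    - by apply: continuous_cts => y; apply: cvg_pair; [exact: cvg_id|exact: cvg_cst].
    - exact: Cn_cts Sk.
  apply: (@cts_closure_eq _ _ B B° (fun y => (h z).2 (y, v))
      (fun y => (h x).2 (y, v))) => //.
  - by apply: ctsB Sz => y [Ay [? ?]].
  - by apply: ctsB Sx => y [Ay [? ?]].
  - exact: interior_subset.
  - move=> y By; apply: (dirder_unique hY (dz y v _) (dx y v _)).
      by apply: interiorS By => w [? []].
    by apply: interiorS By => w [? []].
  - by apply: (dB z); split.
apply: IH; first exact: dense_interiorX.
move=> [x v] [/= Ax _]; have [oW Wx _ Sx] := Hh x Ax.
exists ((h x).1 `*` setT); split => //.
  by apply: open_setX => //; exact: openT.
have -> : (A `*` setT) `&` ((h x).1 `*` setT) = (A `&` (h x).1) `*` [set: X].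
  by apply/seteqP; split => [[y w] [[? ?] [? ?]]|[y w] [[? ?] ?]].
apply: Cn_eq Sx => -[y w] [[/= Ay xy] _].
by rewrite (agree x).
Qed.

End CnLocal.

(** * Linear structure of jet spaces *)

Section Jets.
Context {R : realType}.
Implicit Types X Y Z : tvsType R.

(** The direction in the jet space that moves only the base point. It turns [jshift] into an
    addition, and thereby [dquot] into a directional derivative on the jet space. *)
Fixpoint jemb X k : X -> jet X k :=
  match k with 0%N => id | m.+1 => fun x => (jemb m x, 0) end.

Definition jdom X (A : set X) k := [set p : jet X k | A (jbase p)].

Arguments jdom {X} A k _.

Lemma jshiftE X k (p : jet X k) w : jshift p w = p + jemb k w.
Proof.
elim: k p => [//|k IH] [p v] /=; rewrite IH /GRing.add/= /add_pair/=.
by congr pair; exact/esym/addr0.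
Qed.

Lemma jemb_lin X k : lin (@jemb X k).
Proof.
elim: k => [|k [IHD IHZ]]; first by split.
split => [x y|c x] /=.
  by rewrite IHD; congr pair; exact/esym/addr0.
by rewrite IHZ; congr pair; exact/esym/scaler0.
Qed.

Lemma jemb_cont X k : continuous (@jemb X k).
Proof.
elim: k => [|k IH] x; first exact: cvg_id.
by apply: cvg_pair; [exact: IH|exact: cvg_cst].
Qed.

Lemma jbase_lin X k : lin (@jbase R X k).
Proof.
elim: k => [|k [IHD IHZ]]; first by split.
by split => [x y|c x] /=; rewrite ?IHD ?IHZ.
Qed.

Lemma jbase_cont X k : continuous (@jbase R X k).
Proof.
elim: k => [|k IH] x; first exact: cvg_id.
apply: (@continuous_comp _ _ _ fst (@jbase R X k)); first exact: cvg_fst.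
exact: IH.
Qed.

Lemma jbase_jshift X k (p : jet X k) w : jbase (jshift p w) = jbase p + w.
Proof. by elim: k p => [|k IH] //= [p v] /=; rewrite IH. Qed.

Lemma jdomS X (A : set X) k : jdom A k.+1 = jdom A k `*` [set: X].
Proof. by apply/seteqP; split => [[p v] //|[p v] []]. Qed.

Lemma interior_jdom X (A : set X) k : (jdom A k)° = jdom A° k.
Proof.
elim: k => [//|k IH]; rewrite !jdomS.
have := @interior_setX (jet X k) X (jdom A k); rewrite IH; exact.
Qed.

Lemma dquotE X Y k (g : jet X k -> Y) (p : jet X k) v l :
  (dquot g (p, v : X) --> l) = dirder g p (jemb k v) l.
Proof.
rewrite /dquot /dirder /=.
have -> // : (fun h : R => h^-1 *: (g (jshift p (h *: v)) - g p)) =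
  (fun h : R => h^-1 *: (g (p + h *: jemb k v) - g p)).
by apply/funext => h; rewrite jshiftE (jemb_lin X k).2.
Qed.

End Jets.

Arguments jdom {R X} A k _.

(** * Comparison with the iterated differentials [dn] *)

Section JetCn.
Context {R : realType}.
Implicit Types X Y Z : tvsType R.

Lemma dn_step X Y k (f : X -> Y) (p : jet X k) (v : X) l : hausdorff_space Y ->
  dirder (dn (n := k) f) p (jemb k v) l -> dn (n := k.+1) f (p, v) = l.
Proof.
move=> hY H; rewrite /=; have Hl : dquot (dn (n := k) f) (p, v) --> l by rewrite dquotE.
have Hx : [set l | dquot (dn (n := k) f) (p, v) --> l]
    (xget 0 [set l | dquot (dn (n := k) f) (p, v) --> l]).
  by apply: xgetPex; exists l.
by move: Hx; set y := xget _ _ => /=; rewrite dquotE => /(dirder_unique hY); apply.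
Qed.

(* The jets of [f] factor through the iterated differentials of [F]: [iota]
   embeds the jets of order [k] in the domain of [F]; [kappa] is the direction
   in which it moves with the base point. *)
Lemma Cn_tower Y n : hausdorff_space Y ->
  forall X (A : set X) (f : X -> Y) Z (B : set Z) (F : Z -> Y) k
    (iota : jet X k -> Z) (kappa : X -> Z),
  Cn n B F -> continuous iota -> continuous kappa ->
  (forall p w, iota (p + jemb k w) = iota p + kappa w) ->
  (forall (c : R) w, kappa (c *: w) = c *: kappa w) ->
  (forall p, A (jbase p) -> B (iota p)) ->
  (forall p, A° (jbase p) -> B° (iota p)) ->
  (forall p, A° (jbase p) -> dn (n := k) f p = F (iota p)) ->
  forall j, (k <= j)%N ->
  ((j <= k + n)%N -> exists g : jet X j -> Y, cts (jdom A j) g /\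
     forall p, A° (jbase p) -> g p = dn (n := j) f p) /\
  ((j < k + n)%N -> forall p : jet X j.+1, A° (jbase p) ->
     exists l : Y, dquot (dn (n := j) f) p --> l).
Proof.
move=> hY; elim: n => [|n IH] X A f Z B F k iota kappa SF ic kc ik kZ AB ABi dnE j kj.
  rewrite addn0; split => jk; last by move: jk; rewrite ltnNge kj.
  have jkE : j = k by apply/eqP; rewrite eqn_leq jk kj.
  subst j; exists (F \o iota); split; last by move=> p Ap; rewrite /= dnE.
  by apply: (cts_comp AB) SF; exact: continuous_cts.
have [Fc [F' [dF SF']]] := SF.
have dnF (p : jet X k) v : A° (jbase p) ->
    dirder (dn (n := k) f) p (jemb k v) (F' (iota p, kappa v)).
  move=> Ap; have := dF (iota p) (kappa v) (ABi p Ap).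
  have nA : nbhs p (jdom A° k).
    apply: open_nbhs_nbhs; split => //.
    by rewrite -interior_jdom; exact: open_interior.
  move=> dFp; apply: (@dirder_near _ _ _ (F \o iota)).
    by apply: filterS nA => q Aq; rewrite /= dnE.
  rewrite /dirder /=.
  have -> // : (fun h : R => h^-1 *: (F (iota (p + h *: jemb k v)) - F (iota p))) =
    (fun h : R => h^-1 *: (F (iota p + h *: kappa v) - F (iota p))).
  by apply/funext => h; rewrite -(jemb_lin X k).2 ik kZ.
have [jk|jk] := eqVneq j k.
  subst j; split => _.
    exists (F \o iota); split; last by move=> p Ap; rewrite /= dnE.
    by apply: (cts_comp AB) Fc; exact: continuous_cts.
  move=> [p v] Ap; exists (F' (iota p, kappa v)); rewrite dquotE; exact: dnF.
have kj' : (k < j)%N by rewrite ltn_neqAle eq_sym jk.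
(* The jet (p, v) is sent to (iota p, kappa v). A move of the base point leaves [kappa v] fixed,
   whence the second component 0 of the new direction. *)
have := IH X A f (Z * Z)%type (B `*` setT) F' k.+1
  (fun p => (iota p.1, kappa p.2)) (fun w => (kappa w, 0)) SF'.
rewrite addSnnS; apply => //.
- move=> p; apply: cvg_pair.
    apply: (@continuous_comp _ _ _ fst iota); [exact: cvg_fst|exact: ic].
  apply: (@continuous_comp _ _ _ snd kappa); [exact: cvg_snd|exact: kc].
- by move=> w; apply: cvg_pair; [exact: kc|exact: cvg_cst].
- move=> [p v] w /=; rewrite ik /GRing.add/= /add_pair/=; congr pair.
  by transitivity (kappa v); [congr kappa; exact: addr0|exact/esym/addr0].
- by move=> c w; rewrite kZ; congr pair; exact/esym/scaler0.
- by move=> [p v] Ap; split => //; exact: AB.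
- by move=> [p v] Ap; rewrite interior_setX; split => //; exact: ABi.
- by move=> [p v] Ap; apply: dn_step => //; exact: dnF.
Qed.

Lemma Cn_smooth_dom X Y (A : set X) (f : X -> Y) : hausdorff_space Y ->
  (forall n, Cn n A f) -> smooth_dom A f.
Proof.
move=> hY Sf.
have tower n j := @Cn_tower Y n hY X A f X A f 0%N idfun idfun (Sf n)
  (fun x => cvg_id) (fun x => cvg_id) (fun _ _ => erefl) (fun _ _ => erefl)
  (fun _ => id) (fun _ => id) (fun _ _ => erefl) j (leq0n j).
split; first exact/ctsP/(Cn_cts (Sf 0%N)).
- move=> n; split => k kn; first exact: (tower n k).2.
  have [g [gc gE]] := (tower n k).1 kn.
  apply/ctsP; apply: (@cts_eq _ _ _ g); first exact: gE.
  by apply: cts_sub gc => p; exact: interior_subset.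
- move=> n; have [g [gc gE]] := (tower n n).1 (leqnn n).
  by exists g; split => //; exact/ctsP.
Qed.

(** The jet [p] with v_(i+1) replaced by the corresponding direction of [q], slots being counted
    from 0: the arguments in the product rule for a multilinear map. *)
Fixpoint jrepl X k (i : nat) : jet X k -> jet X k -> jet X k :=
  match k with
  | 0%N => fun p _ => p
  | m.+1 => fun p q => if i == m then (p.1, q.2) else (jrepl i p.1 q.1, p.2)
  end.

(** Moves the directions of [p] along those of [q] and keeps the base point, so that [p + h *: q]
    splits into this vertical move and a move of the base point. *)
Fixpoint jvert X k : jet X k -> jet X k -> R -> jet X k :=
  match k with
  | 0%N => fun p _ _ => p
  | m.+1 => fun p q h => (jvert p.1 q.1 h, p.2 + h *: q.2)
  end.

Lemma jbase_repl X k i (p q : jet X k) : jbase (jrepl i p q) = jbase p.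
Proof.
elim: k p q => [//|k IH] [p v] [q u] /=.
by case: ifP => _ /=.
Qed.

Lemma jrepl_lin X k i : @lin R (jet X k * jet X k)%type (jet X k) (fun z => jrepl i z.1 z.2).
Proof.
elim: k => [|k [IHD IHZ]]; first by split.
split => [[[p v] [q u]] [[p' v'] [q' u']]|c [[p v] [q u]]] /=.
  by case: ifP => _ //=; rewrite (IHD (p, q) (p', q')).
by case: ifP => _ //=; rewrite (IHZ c (p, q)).
Qed.

Lemma jrepl_cont X k i : continuous (fun z : (jet X k * jet X k)%type => jrepl i z.1 z.2).
Proof.
elim: k => [|k IH]; first exact: continuous_fst.
move=> z /=; case: (i == k).
  apply: cvg_pair; first by apply: cvg_comp; [exact: cvg_fst|exact: cvg_fst].
  by apply: cvg_comp; [exact: cvg_snd|exact: cvg_snd].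
apply: cvg_pair; last by apply: cvg_comp; [exact: cvg_fst|exact: cvg_snd].
apply: (@continuous_comp _ _ _ (fun z : (jet X k.+1 * jet X k.+1)%type => (z.1.1, z.2.1))
  (fun z => jrepl i z.1 z.2)); last exact: IH.
apply: cvg_pair; first by apply: cvg_comp; [exact: cvg_fst|exact: cvg_fst].
by apply: cvg_comp; [exact: cvg_snd|exact: cvg_fst].
Qed.

Lemma jvertE X k (p q : jet X k) (h : R) :
  p + h *: q = jvert p q h + h *: jemb k (jbase q).
Proof.
elim: k p q => [//|k IH] [p v] [q u] /=.
have -> : (p, v) + h *: (q, u) = (p + h *: q, v + h *: u) by [].
rewrite IH; congr pair.
by rewrite [RHS]/= scaler0 addr0.
Qed.

Lemma jbase_vert X k (p q : jet X k) (h : R) : jbase (jvert p q h) = jbase p.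
Proof. by elim: k p q => [//|k IH] [p v] [q u] /=. Qed.

Lemma jvert_cvg X k (p q : jet X k) : jvert p q h @[h --> (0 : R)^'] --> p.
Proof.
elim: k p q => [|k IH] /=; first by move=> p q; exact: cvg_cst.
move=> [p v] [q u]; apply: cvg_pair => /=; first exact: IH.
suff : v + h *: u @[h --> (0 : R)^'] --> v + (0 : R) *: u by rewrite scale0r addr0.
apply: tcvgD; first exact: cvg_cst.
by apply: tcvgZ; [exact: nbhs_dnbhs|exact: cvg_cst].
Qed.

Fixpoint mlin X Y (V : set X) k : (jet X k -> Y) -> Prop :=
  match k with
  | 0%N => fun _ => True
  | m.+1 => fun G =>
    (forall p v u (c : R), V (jbase p) -> G (p, v + c *: u) = G (p, v) + c *: G (p, u)) /\
    forall v, mlin V (fun p => G (p, v))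
  end.

(** Product rule. Linearity in the last slot splits off the term [G (jvert p q h, u)], which
    converges by continuity; what remains is the quotient with the last slot fixed. *)
Lemma mlin_vert X Y (V : set X) k (G : jet X k -> Y) (p q : jet X k) :
  mlin V G -> (forall p, V (jbase p) -> G p' @[p' --> p] --> G p) -> V (jbase p) ->
  h^-1 *: (G (jvert p q h) - G p) @[h --> (0 : R)^'] --> \sum_(i < k) G (jrepl i p q).
Proof.
elim: k G p q => [|k IH] G p q.
  move=> _ _ _; rewrite big_ord0; apply: cvg_near_cst; near=> h.
  by rewrite /= subrr scaler0.
case: p q => [p v] [q u] [GD Gm] Gc Vp; rewrite big_ord_recr /= eqxx.
rewrite (eq_bigr (fun i : 'I_k => G (jrepl i p q, v))); last first.
  by move=> i _; rewrite ltn_eqF.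
suff : h^-1 *: (G (jvert p q h, v) - G (p, v)) + G (jvert p q h, u)
    @[h --> (0 : R)^'] --> \sum_(i < k) G (jrepl i p q, v) + G (p, u).
  apply: cvg_trans; apply: near_eq_cvg; near=> h.
  have h0 : h != 0 by near: h; exact: nbhs_dnbhs_neq.
  rewrite /= GD ?jbase_vert// [X in _ = _ *: X]addrAC [RHS]scalerDr; congr (_ + _).
  by rewrite scalerA mulVf// scale1r.
apply: tcvgD.
  apply: (IH (fun p => G (p, v))) => //; first exact: Gm.
  move=> p' Vp'; apply: (@cvg_comp _ _ _ (fun p => (p, v)) G _
      (nbhs ((p', v) : jet X k.+1))); last exact: (Gc (p', v)).
  by apply: cvg_pair; [exact: cvg_id|exact: cvg_cst].
apply: (@cvg_comp _ _ _ (fun h => (jvert p q h, u)) G _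
  (nbhs ((p, u) : jet X k.+1))); last exact: (Gc (p, u)).
by apply: cvg_pair; [exact: jvert_cvg|exact: cvg_cst].
Unshelve. all: by end_near. Qed.

Lemma near_base X (V : set X) k (p : jet X k) v : open V -> V (jbase p) ->
  \forall h \near (0 : R)^', V (jbase (jshift p (h *: v))).
Proof.
move=> oV Vp; have : jbase p + h *: v @[h --> (0 : R)] --> jbase p.
  suff : jbase p + h *: v @[h --> (0 : R)] --> jbase p + (0 : R) *: v.
    by rewrite scale0r addr0.
  apply: tcvgD; first exact: cvg_cst.
  by apply: tcvgZ; [exact: cvg_id|exact: cvg_cst].
move=> /(_ V (open_nbhs_nbhs (conj oV Vp))) H; apply: nbhs_dnbhs.
have {}H : nbhs (0 : R) [set h : R | V (jbase p + h *: v)] := H.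
by apply: filterS H => h; rewrite jbase_jshift.
Qed.

(** Linear identities pass to limits of difference quotients in the base point, which stays in the
    open set [V] for small h. Applied to d^k f, this makes d^(k+1) f multilinear in its first k
    slots. *)
Lemma mlin_lim X Y (V : set X) k (G H : jet X k -> Y) v : hausdorff_space Y -> open V ->
  (forall p, V (jbase p) -> h^-1 *: (G (jshift p (h *: v)) - G p) @[h --> (0 : R)^'] --> H p) ->
  mlin V G -> mlin V H.
Proof.
move=> hY oV; elim: k G H => [//|k IH] G H GH [GD Gm]; split; last first.
  move=> u; apply: (IH (fun p => G (p, u)) _ _ (Gm u)) => p Vp.
  exact: (GH (p, u)).
move=> p u w c Vp; apply: (cvg_unique hY (GH (p, u + c *: w) Vp)).
apply: (@cvg_trans _ (h^-1 *: (G (jshift p (h *: v), u) - G (p, u)) +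
    c *: (h^-1 *: (G (jshift p (h *: v), w) - G (p, w))) @[h --> (0 : R)^']));
  last first.
  apply: tcvgD; first exact: (GH (p, u) Vp).
  by apply: tcvgZ; [exact: cvg_cst|exact: (GH (p, w) Vp)].
apply: near_eq_cvg; near=> h.
have Vh : V (jbase (jshift p (h *: v))) by near: h; exact: near_base.
rewrite /= !GD// opprD [X in _ = _ *: X]addrACA -scalerBr [RHS]scalerDr; congr (_ + _).
by rewrite !scalerA mulrC.
Unshelve. all: by end_near. Qed.

(* Quotients in direction [v + c *: u] split into one based at [p] and one based
   at the moving point [p + h *: v]. *)
Lemma dirder_linear X Y k (V : set X) (G : jet X k -> Y) (D : jet X k.+1 -> Y) :
  hausdorff_space Y -> open V ->
  (forall p v, V (jbase p) -> dirder G p (jemb k v) (D (p, v))) ->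
  (forall p, V (jbase p) -> D p' @[p' --> p] --> D p) ->
  forall p v u (c : R), V (jbase p) -> D (p, v + c *: u) = D (p, v) + c *: D (p, u).
Proof.
move=> hY oV dG Dc p v u c Vp.
have openJ : open (jdom V k).
  rewrite -[V in jdom V](proj1 (interior_id _) oV) -interior_jdom.
  exact: open_interior.
have lj := jemb_lin X k.
have DZ : D (p, c *: u) = c *: D (p, u).
  have [->|c0] := eqVneq c 0.
    rewrite !scale0r; apply: (dirder_unique hY (dG p 0 Vp)).
    rewrite -(scale0r (0 : X)) lj.2 scale0r.
    by apply: cvg_near_cst; near=> h; rewrite scaler0 addr0 subrr scaler0.
  apply: (dirder_unique hY (dG p _ Vp)); rewrite lj.2 /dirder.
  have -> : (fun h : R => h^-1 *: (G (p + h *: (c *: jemb k u)) - G p)) =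
     (fun h : R => c *: ((h * c)^-1 *: (G (p + (h * c) *: jemb k u) - G p))).
    by apply/funext => h; rewrite !scalerA invfM mulrCA mulfV// mulr1.
  apply: tcvgZ; first exact: cvg_cst.
  apply: (@cvg_comp _ _ _ (fun h : R => h * c)
    (fun h => h^-1 *: (G (p + h *: jemb k u) - G p)) _ ((0 : R)^')).
    exact: mul_dnbhs0.
  exact: dG.
apply: (dirder_unique hY (dG p _ Vp)); rewrite lj.1 -DZ [D (p, v) + _]addrC /dirder.
have pc (w : jet X k) : p + h *: w @[h --> (0 : R)^'] --> p.
  suff : p + h *: w @[h --> (0 : R)^'] --> p + (0 : R) *: w by rewrite scale0r addr0.
  apply: tcvgD; first exact: cvg_cst.
  by apply: tcvgZ; [exact: nbhs_dnbhs|exact: cvg_cst].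
apply: (@cvg_trans _ (
   h^-1 *: (G ((p + h *: jemb k v) + h *: jemb k (c *: u)) - G (p + h *: jemb k v)) +
   h^-1 *: (G (p + h *: jemb k v) - G p) @[h --> (0 : R)^'])).
  apply: near_eq_cvg; near=> h.
  rewrite -[LHS]scalerDr addrA subrK; congr (_ *: (G _ - _)).
  by rewrite scalerDr addrA.
apply: tcvgD; last exact: dG.
apply: (@quot_cvg _ _ ((0 : R)^') _ X (jet X k) Y (@jemb R X k) G D
   (fun h => p + h *: jemb k v) (fun=> c *: u) id p (c *: u)).
- exact: lj.2.
- exact: jemb_cont.
- by apply: filterS (open_nbhs_nbhs (conj openJ Vp)) => q Vq w; exact: dG.
- exact: (Dc (p, c *: u)).
- exact: pc.
- exact: cvg_cst.
- exact: nbhs_dnbhs.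
- exact: nbhs_dnbhs_neq.
Unshelve. all: by end_near. Qed.

(** The increment along [q] is split at [jvert p q h]. The vertical part yields the sum by the
    product rule; the rest moves the base point in the direction [jbase q], starting from a point
    that itself depends on h, and is handled by [quot_cvg]. *)
Lemma dirder_jet X Y k (V : set X) (G : jet X k -> Y) (D : jet X k.+1 -> Y) :
  open V -> mlin V G ->
  (forall p, V (jbase p) -> G p' @[p' --> p] --> G p) ->
  (forall p v, V (jbase p) -> dirder G p (jemb k v) (D (p, v))) ->
  (forall p, V (jbase p) -> D p' @[p' --> p] --> D p) ->
  forall p q, V (jbase p) ->
  dirder G p q (D (p, jbase q) + \sum_(i < k) G (jrepl i p q)).
Proof.
move=> oV mG Gc dG Dc p q Vp; rewrite /dirder.
have openJ : open (jdom V k).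
  rewrite -[V in jdom V](proj1 (interior_id _) oV) -interior_jdom.
  exact: open_interior.
apply: (@cvg_trans _ (h^-1 *: (G (jvert p q h + h *: jemb k (jbase q)) - G (jvert p q h)) +
   h^-1 *: (G (jvert p q h) - G p) @[h --> (0 : R)^'])).
  apply: near_eq_cvg; near=> h.
  by rewrite -[LHS]scalerDr addrA subrK -jvertE.
apply: tcvgD; last exact: mlin_vert mG Gc Vp.
apply: (@quot_cvg _ _ ((0 : R)^') _ X (jet X k) Y (@jemb R X k) G D
   (fun h => jvert p q h) (fun=> jbase q) id p (jbase q)).
- exact: (jemb_lin X k).2.
- exact: jemb_cont.
- by apply: filterS (open_nbhs_nbhs (conj openJ Vp)) => z Vz w; exact: dG.
- exact: (Dc (p, jbase q)).
- exact: jvert_cvg.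
- exact: cvg_cst.
- exact: nbhs_dnbhs.
- exact: nbhs_dnbhs_neq.
Unshelve. all: by end_near. Qed.

(** On the interior, [dirder_jet] differentiates d^k f in all variables of the jet. The same
    formula, written with the continuous extensions of the differentials, is the derivative that
    [Cn] asks for on all of [A]. *)
Lemma smooth_dom_Cn X Y (A : set X) (f : X -> Y) : hausdorff_space Y ->
  smooth_dom A f -> forall n, Cn n A f.
Proof.
move=> hY [fc fC fext] n.
have oV : open A° by exact: open_interior.
have dE k (p : jet X k) v : A° (jbase p) ->
    dirder (dn (n := k) f) p (jemb k v) (dn (n := k.+1) f (p, v)).
  move=> Ap; have [/(_ k (ltnSn k) (p, v) Ap)[l dl] _] := fC k.+1.
  by rewrite dquotE in dl; rewrite (dn_step hY dl).
have dc k (p : jet X k) : A° (jbase p) -> dn (n := k) f p' @[p' --> p] --> dn (n := k) f p.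
  move=> Ap; have [_ /(_ k (leqnn k)) /ctsP H] := fC k.
  by apply: cts_interior H _; rewrite [X in X _](interior_jdom A° k) (proj1 (interior_id _) oV).
have dm k : mlin A° (dn (n := k) f).
  elim: k => [//|k IH]; split.
    by apply: (dirder_linear hY oV); [exact: dE|exact: dc].
  move=> v; apply: (@mlin_lim _ _ _ _ _ _ v hY oV _ IH) => p Ap.
  by have := dE k p v Ap; rewrite -dquotE.
have Hex k : exists g : jet X k -> Y,
    cts (jdom A k) g /\ (forall p, A° (jbase p) -> g p = dn (n := k) f p).
  by have [g [/ctsP gc gE]] := fext k; exists g.
pose g k := sval (cid (Hex k)).
have Hg k : cts (jdom A k) (g k) /\
  (forall p, A° (jbase p) -> g k p = dn (n := k) f p) := svalP (cid (Hex k)).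
(* Order 0 is taken to be [f] itself: the extension [g 0] is only known to equal [f] on the
   interior, whereas the claim concerns [f] on all of [A]. *)
pose g' k := match k return jet X k -> Y with 0%N => f | m.+1 => g m.+1 end.
have Hg' : forall k, cts (jdom A k) (g' k) /\
    (forall p, A° (jbase p) -> g' k p = dn (n := k) f p).
  by case=> [|k]; [split => //; exact/ctsP|exact: Hg].
(* All [k] at once: the derivative of the extension of order k involves those of orders k and k +
   1. *)
suff SG : forall n k, Cn n (jdom A k) (g' k) by exact: (SG n 0%N).
move: g' Hg' => {Hg}g Hg.
clear n.
elim=> [|m IH] k; first exact: (Hg k).1.
  split; first exact: (Hg k).1.
  exists (fun z => g k.+1 (z.1, jbase z.2) + \sum_(i < k) g k (jrepl i z.1 z.2)).
  split.
    move=> p q; rewrite interior_jdom => Ap.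
    have nA : nbhs p (jdom A° k).
      apply: open_nbhs_nbhs; split => //.
      by rewrite -interior_jdom; exact: open_interior.
    apply: (@dirder_near _ _ _ (dn (n := k) f)).
      by apply: filterS nA => z Az; rewrite (Hg k).2.
    rewrite (Hg k.+1).2//.
    under eq_bigr do rewrite (Hg k).2 ?jbase_repl//.
    by apply: (dirder_jet oV) => //; [exact: dc|exact: dE|exact: dc].
  have int_fst : forall z : (jet X k * jet X k)%type,
      (jdom A k `*` setT)° z -> A° (jbase z.1).
    by move=> z; rewrite interior_setX => -[]; rewrite interior_jdom.
  apply: Cn_add.
    apply: (@Cn_comp _ m _ (jet X k.+1) Y _ (jdom A k.+1)
      (fun z => (z.1, jbase z.2)) (g k.+1)); last exact: IH.
    - by move=> z [].
    - by move=> z /int_fst; rewrite interior_jdom.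
    - apply: Cn_lin; last first.
        move=> z; apply: cvg_pair; first exact: cvg_fst.
        apply: (@continuous_comp _ _ _ snd (@jbase R X k)); first exact: cvg_snd.
        exact: jbase_cont.
      have [bD bZ] := jbase_lin X k.
      by split => [x y|c x] /=; rewrite ?bD ?bZ.
  have S_repl i : Cn m (jdom A k `*` setT) (fun z => g k (jrepl i z.1 z.2)).
    apply: (@Cn_comp _ m _ (jet X k) Y _ (jdom A k)
      (fun z => jrepl i z.1 z.2) (g k)); last exact: IH.
    - by move=> z [Az _]; rewrite /jdom /= jbase_repl.
    - by move=> z /int_fst Az; rewrite interior_jdom /jdom /= jbase_repl.
    - apply: Cn_lin; [exact: jrepl_lin|exact: jrepl_cont].
  suff : forall j, Cn m (jdom A k `*` setT)
      (fun z : (jet X k * jet X k)%type => \sum_(i < j) g k (jrepl i z.1 z.2)) by exact.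
  elim=> [|j IHj].
    apply: (@Cn_eq _ _ _ _ _ (fun=> 0)); last exact: Cn_cst.
    by move=> z _; rewrite big_ord0.
  apply: (@Cn_eq _ _ _ _ _ (fun z => \sum_(i < j) g k (jrepl i z.1 z.2) +
    g k (jrepl j z.1 z.2))); last exact: Cn_add.
  by move=> z _; rewrite big_ord_recr.
Qed.

End JetCn.

(** * Bump functions *)

Section Bump.
Context {R : realType}.

Lemma is_derive_cderiv (f : R -> R) (x l : R) : is_derive x (1 : R) f l ->
  cderiv (f : R -> R^o) x l.
Proof.
move=> [df fl]; rewrite /cderiv -fl.
have -> : (fun h : R => h^-1 *: ((f (x + h) : R^o) - f x)) =
    (fun h : R => h^-1 *: ((f \o shift x) (h *: (1 : R)) - f x)).
  by apply/funext => h; congr (_ *: (f _ - _)); rewrite /= [h%:A]mulr1 addrC.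
exact: df.
Qed.

Lemma cderiv_dirder (f : R -> R) (x v l : R) :
  cderiv (f : R -> R^o) x l -> dirder (f : R^o -> R^o) x v (v * l).
Proof.
move=> df; have [->|v0] := eqVneq v 0.
  rewrite mul0r; apply: cvg_near_cst; near=> h.
  by rewrite scaler0 addr0 subrr scaler0.
rewrite /dirder.
have -> : (fun h : R => h^-1 *: (f (x + h *: (v : R^o)) - f x : R^o)) =
    (fun h : R => v *: ((h * v)^-1 *: (f (x + h * v) - f x : R^o))).
  by apply/funext => h; rewrite !scalerA invfM mulrCA mulfV// mulr1.
apply: (@tcvgZ R R^o); first exact: cvg_cst.
apply: (@cvg_comp _ _ _ (fun h : R => h * v)
    (fun h => h^-1 *: (f (x + h) - f x : R^o)) _ ((0 : R)^')); last exact: df.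
exact: mul_dnbhs0.
Unshelve. all: by end_near. Qed.

Lemma cderiv_continuous (f : R -> R) (x l : R) :
  cderiv (f : R -> R^o) x l -> {for x, continuous f}.
Proof.
move=> df; apply/continuous_withinNshiftx => /=.
suff : f x + h * (h^-1 * (f (x + h) - f x)) @[h --> 0^'] --> f x + 0 * l.
  rewrite mul0r addr0; apply: cvg_trans; apply: near_eq_cvg; near=> h => /=.
  have h0 : h != 0 by near: h; exact: nbhs_dnbhs_neq.
  by rewrite mulrA divff// mul1r addrC subrK addrC.
apply: cvgD; first exact: cvg_cst.
by apply: cvgM; [exact: nbhs_dnbhs|exact: df].
Unshelve. all: by end_near. Qed.

Lemma Cn_real n (A : set R^o) (f g : R -> R) :
  (forall x, A x -> cderiv (f : R -> R^o) x (g x)) ->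
  Cn n A (g : R^o -> R^o) -> Cn n.+1 A (f : R^o -> R^o).
Proof.
move=> df Sg; split.
  by move=> x Ax; apply: cvg_within_filter; apply: cderiv_continuous (df x Ax).
exists (fun p => p.2 *: (g p.1 : R^o)); split.
  by move=> x v Ax; apply: cderiv_dirder; exact: df (interior_subset Ax).
apply: (@Cn_scale _ _ _ R^o _ snd (fun p => g p.1)).
  by apply: Cn_lin => //; exact: continuous_snd.
apply: (@Cn_comp _ _ _ R^o R^o _ A fst g) => //.
- by move=> p [].
- by move=> p; rewrite interior_setX => -[].
- by apply: Cn_lin => //; exact: continuous_fst.
Qed.

Lemma Cn_mul n (X : tvsType R) (A : set X) (f g : X -> R) :
  Cn n A (f : X -> R^o) -> Cn n A (g : X -> R^o) -> Cn n A (fun x => f x * g x : R^o).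
Proof. exact: (@Cn_scale R n X R^o). Qed.

(** The derivative is minus the square of the function itself, so the induction feeds on its own
    statement. *)
Lemma Cn_inv n : Cn n [set x : R^o | 0 < x] (fun x : R^o => (x : R)^-1 : R^o).
Proof.
have dinv (x : R) : 0 < x -> cderiv (fun y : R => y^-1 : R^o) x (-1 * (x^-1 * x^-1)).
  move=> x0; apply: is_derive_cderiv.
  apply: (is_derive_eq (@is_deriveV _ id x _ 1 _ _)); first by rewrite gt_eqF.
  by rewrite [_ *: _]mulr1 expr2 invfM mulN1r.
elim: n => [|n IH].
  by move=> x Ax; apply: cvg_within_filter; apply: cderiv_continuous (dinv x Ax).
apply: Cn_real; first exact: dinv.
by apply: Cn_mul; [exact: Cn_cst|exact: Cn_mul].
Qed.

(** The whole family in [k] is introduced because it is closed under differentiation up to linear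
    combinations; smoothness of e^(-1/x) then follows by an induction over all [k] together. *)
Definition flat k (x : R) : R := if 0 < x then x^-1 ^+ k * expR (- x^-1) else 0.

Lemma flat0 k (x : R) : x <= 0 -> flat k x = 0.
Proof. by rewrite /flat ltNge => ->. Qed.

Lemma flat_gt0 k (x : R) : 0 < x -> 0 < flat k x.
Proof. by move=> x0; rewrite /flat x0 mulr_gt0 ?exprn_gt0 ?invr_gt0 ?expR_gt0. Qed.

Lemma flat_ge0 k (x : R) : 0 <= flat k x.
Proof. by have [/flat0->//|/(flat_gt0 k)/ltW] := leP x 0. Qed.

(** With t = 1/x, the bound e^t >= t^(k+1) / (k+1)! gives t^k e^(-t) <= (k+1)! / t. The spare power
    of t is what forces convergence to 0. *)
Lemma flat_le k (x : R) : flat k x <= (k.+1)`!%:R * `|x|.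
Proof.
have [x0|x0] := leP x 0; first by rewrite flat0// mulr_ge0.
rewrite gtr0_norm// /flat x0 expRN.
set t := x^-1; have t0 : 0 <= t by rewrite invr_ge0 ltW.
have := expR_ge1Dxn k t0; set e := expR t; have e0 : 0 < e by exact: expR_gt0.
have f0 : 0 < (k.+1)`!%:R :> R by rewrite ltr0n fact_gt0.
move=> H; rewrite ler_pdivrMr//.
have {}H : t ^+ k.+1 <= (k.+1)`!%:R * e.
  by rewrite -ler_pdivrMl// mulrC; apply: le_trans H; rewrite lerDr.
have -> : t ^+ k = x * t ^+ k.+1 by rewrite exprS mulrA mulfV ?mul1r// gt_eqF.
by rewrite -mulrA mulrCA ler_pM2l.
Qed.

Lemma flat_cvg0 k : flat k x @[x --> (0 : R)] --> (0 : R).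
Proof.
apply/cvgr0Pnorm_lt => e e0.
have f0 : 0 < (k.+1)`!%:R :> R by rewrite ltr0n fact_gt0.
near=> x; rewrite ger0_norm ?flat_ge0//; apply: le_lt_trans (flat_le k x) _.
rewrite -ltr_pdivlMl// mulrC.
near: x; apply: (@cvgr0_norm_lt _ _ _ _ _ id); first exact: cvg_id.
by rewrite divr_gt0.
Unshelve. all: by end_near. Qed.

Lemma flat_cderiv k (x : R) :
  cderiv (flat k : R -> R^o) x (- k%:R * flat k.+1 x + flat k.+2 x).
Proof.
have [x0|x0|->] := ltgtP x 0.
- rewrite !flat0 ?ltW// mulr0 addr0.
  apply: cvg_near_cst; near=> h.
  rewrite !flat0 ?ltW ?subrr ?scaler0//.
  rewrite -ltrBrDl sub0r; apply: le_lt_trans (ler_norm h) _.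
  by near: h; apply: dnbhs0_lt; rewrite oppr_gt0.
- suff H : is_derive x (1 : R) (fun y : R => y^-1 ^+ k * expR (- y^-1))
      (- k%:R * flat k.+1 x + flat k.+2 x).
    have := is_derive_cderiv H; apply: cvg_trans; apply: near_eq_cvg; near=> h.
    rewrite /flat x0 ifT//.
    rewrite -ltrBlDl sub0r ltrNl; apply: le_lt_trans (ler_norm _) _.
    by rewrite normrN; near: h; exact: dnbhs0_lt.
  have xn0 : x != 0 by rewrite gt_eqF.
  have du : is_derive x (1 : R) (fun y : R => y^-1) (- x ^- 2 *: (1 : R)).
    exact: (@is_deriveV _ id).
  have de := @is_derive1_comp _ expR (- (fun y : R => y^-1)) x _ _
    (is_derive_expR _) (is_deriveN du).
  have := is_deriveM (is_deriveX k du) de.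
  have -> : ((fun y : R => y^-1) ^+ k * (expR \o - (fun y : R => y^-1))) =
    (fun y : R => y^-1 ^+ k * expR (- y^-1)).
    by apply/funext => y; rewrite /GRing.mul/= exprfctE.
  move=> H; apply: (is_derive_eq H); rewrite exprfctE /flat x0.
  rewrite /comp.
  have -> : expR ((- (fun y : R => y^-1)) x) = expR (- x^-1) by [].
  rewrite /GRing.scale/= !mulr1 -exprVn opprK.
  case: k {H} => [|k] /=; rewrite !exprS ?expr0; first by ring.
  by move: (x^-1 ^+ k) (x^-1) (expR (- x^-1)) (k.+1%:R) => a b c e; ring.
(* At 0 the difference quotient of [flat k] is [flat k.+1 h], which tends to 0. *)
- rewrite !flat0// mulr0 addr0.
  have : flat k.+1 h @[h --> (0 : R)^'] --> (0 : R).
    by apply: cvg_within_filter; exact: flat_cvg0.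
  apply: cvg_trans; apply: near_eq_cvg; near=> h.
  rewrite add0r [flat k 0]flat0// subr0 /flat; case: ifP => _; last by rewrite scaler0.
  by rewrite exprS -mulrA.
Unshelve. all: by end_near. Qed.

Lemma Cn_flat n k : Cn n setT (flat k : R^o -> R^o).
Proof.
elim: n k => [|n IH] k.
  by move=> x _; apply: cvg_within_filter; apply: cderiv_continuous (@flat_cderiv k x).
apply: Cn_real; first by move=> x _; exact: flat_cderiv.
by apply: Cn_add => //; apply: Cn_mul => //; exact: Cn_cst.
Qed.

Definition sstep (x : R) : R := flat 0 x * (flat 0 x + flat 0 (1 - x))^-1.

Lemma sstep_den (x : R) : 0 < flat 0 x + flat 0 (1 - x).
Proof.
have [x0|x0] := ltP 0 x; first by rewrite ltr_wpDr ?flat_ge0 ?flat_gt0.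
by rewrite ltr_wpDl ?flat_ge0// flat_gt0//; lra.
Qed.

Lemma sstep0 (x : R) : x <= 0 -> sstep x = 0.
Proof. by move=> x0; rewrite /sstep flat0// mul0r. Qed.

Lemma sstep1 (x : R) : 1 <= x -> sstep x = 1.
Proof.
move=> x1; rewrite /sstep [flat 0 (1 - x)]flat0 ?addr0; last lra.
by rewrite mulfV// gt_eqF// flat_gt0//; lra.
Qed.

Lemma sstep_itv (x : R) : 0 <= sstep x <= 1.
Proof.
have d0 := sstep_den x; rewrite /sstep divr_ge0 ?flat_ge0 ?(ltW d0)//=.
by rewrite ler_pdivrMr// mul1r lerDl flat_ge0.
Qed.

Lemma Cn_sstep n : Cn n setT (sstep : R^o -> R^o).
Proof.
apply: Cn_mul; first exact: Cn_flat.
apply: (@Cn_comp _ _ _ R^o R^o _ [set x : R^o | 0 < x]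
  (fun x : R^o => flat 0 x + flat 0 (1 - x) : R^o) (fun x : R^o => (x : R)^-1 : R^o)).
- by move=> x _; exact: sstep_den.
- move=> x _; have /interior_id -> : open [set x : R^o | 0 < x] by exact: open_gt.
  exact: sstep_den.
- apply: Cn_add; first exact: Cn_flat.
  apply: (@Cn_compT _ _ _ R^o R^o _ (fun x : R^o => 1 - x : R^o) (flat 0)); last exact: Cn_flat.
  apply: Cn_add; first exact: Cn_cst.
  apply: Cn_lin; last exact: opp_continuous.
  by split => [x y|c x] /=; rewrite ?opprD ?scalerN.
- exact: Cn_inv.
Qed.

(** The slope 2 / r makes 2 - (2 / r)(x - a) at least 1 for x - a <= r / 2 and at most 0 for x - a
    >= r; the second factor does the same on the other side of [a]. *)
Definition plateau (a r x : R) : R :=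
  sstep (2 - 2 / r * (x - a)) * sstep (2 + 2 / r * (x - a)).

Lemma plateau_itv a r x : 0 <= plateau a r x <= 1.
Proof.
rewrite /plateau; have /andP[a0 a1] := sstep_itv (2 - 2 / r * (x - a)).
have /andP[b0 b1] := sstep_itv (2 + 2 / r * (x - a)).
by rewrite mulr_ge0//= mulr_ile1.
Qed.

Lemma plateau1 a r x : 0 < r -> `|x - a| <= r / 2 -> plateau a r x = 1.
Proof.
move=> r0; rewrite ler_norml => /andP[h1 h2]; rewrite /plateau !sstep1 ?mulr1//.
- have : - 1 <= 2 / r * (x - a); last lra.
  by rewrite mulrAC ler_pdivlMr//; lra.
- have : 2 / r * (x - a) <= 1; last lra.
  by rewrite mulrAC ler_pdivrMr//; lra.
Qed.

Lemma plateau0 a r x : 0 < r -> r <= `|x - a| -> plateau a r x = 0.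
Proof.
move=> r0; rewrite ler_normr => /orP[h|h]; rewrite /plateau.
- rewrite sstep0 ?mul0r//.
  have : 2 <= 2 / r * (x - a); last lra.
  by rewrite mulrAC ler_pdivlMr//; lra.
- rewrite [X in _ * X]sstep0 ?mulr0//.
  have : 2 / r * (x - a) <= - 2; last lra.
  by rewrite mulrAC ler_pdivrMr//; lra.
Qed.

Lemma Cn_plateau n a r : Cn n setT (plateau a r : R^o -> R^o).
Proof.
have aff (c : R) : Cn n setT (fun x : R^o => 2 + c * (x - a) : R^o).
  apply: Cn_add; first exact: Cn_cst.
  apply: Cn_mul; first exact: Cn_cst.
  apply: (@Cn_add _ n R^o R^o setT id (fun=> - a)); last exact: Cn_cst.
  by apply: Cn_lin => // x; exact: cvg_id.
apply: Cn_mul.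
  apply: (@Cn_compT _ _ _ R^o R^o _ (fun x : R^o => 2 - 2 / r * (x - a) : R^o) sstep).
    by apply: Cn_eq (aff (- (2 / r))) => x _; rewrite mulNr.
  exact: Cn_sstep.
apply: (@Cn_compT _ _ _ R^o R^o _ (fun x : R^o => 2 + 2 / r * (x - a) : R^o) sstep) => //.
exact: Cn_sstep.
Qed.

Lemma Cn_coord n d (i : 'I_d) : Cn n [set: 'rV[R]_d] (fun x : 'rV[R]_d => x ord0 i : R^o).
Proof.
apply: Cn_lin; first by split => [x y|c x]; rewrite mxE.
exact: coord_continuous.
Qed.

Definition cube_bump d (a : 'rV[R]_d) (r : R) (x : 'rV[R]_d) : R :=
  \prod_i plateau (a ord0 i) r (x ord0 i).

Lemma Cn_cube_bump n d (a : 'rV[R]_d) r : Cn n setT (cube_bump a r : 'rV[R]_d -> R^o).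
Proof.
rewrite /cube_bump; elim: (index_enum _) => [|i s IH].
  apply: (@Cn_eq R n 'rV[R]_d R^o setT (fun=> 1 : R^o)); last exact: Cn_cst.
  by move=> x _; rewrite big_nil.
apply: (@Cn_eq R n 'rV[R]_d R^o setT (fun x : 'rV[R]_d => plateau (a ord0 i) r (x ord0 i) *
    \prod_(j <- s) plateau (a ord0 j) r (x ord0 j) : R^o)).
  by move=> x _; rewrite big_cons.
apply: Cn_mul => //.
apply: (@Cn_compT _ _ _ R^o R^o _ (fun x : 'rV[R]_d => x ord0 i : R^o)
  (plateau (a ord0 i) r)); [exact: Cn_coord|exact: Cn_plateau].
Qed.

Lemma cube_bump_itv d (a : 'rV[R]_d) r x : 0 <= cube_bump a r x <= 1.
Proof.
rewrite /cube_bump; apply/andP; split.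
  by apply: prodr_ge0 => i _; have /andP[] := plateau_itv (a ord0 i) r (x ord0 i).
by apply: prodr_ile1 => i _; exact: plateau_itv.
Qed.

Lemma cube_bump1 d (a : 'rV[R]_d) r (x : 'rV[R]_d) : 0 < r ->
  (forall i, `|x ord0 i - a ord0 i| <= r / 2) -> cube_bump a r x = 1.
Proof. by move=> r0 H; rewrite /cube_bump big1// => i _; rewrite plateau1. Qed.

Lemma cube_bump0 d (a : 'rV[R]_d) r (x : 'rV[R]_d) i : 0 < r ->
  r <= `|x ord0 i - a ord0 i| -> cube_bump a r x = 0.
Proof. by move=> r0 H; rewrite /cube_bump (bigD1 i)//= plateau0 ?mul0r. Qed.

Definition cube d (a : 'rV[R]_d) (r : R) : set 'rV[R]_d :=
  [set x | forall i, `|x ord0 i - a ord0 i| <= r].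

Lemma cube_nbhs d (a : 'rV[R]_d) r : 0 < r -> nbhs a (cube a r).
Proof.
move=> r0; apply/nbhs_ballP; exists r => //= x [_ H] i.
by have := H ord0 i; rewrite /ball /= distrC => /ltW.
Qed.

Lemma cube_sub d (a : 'rV[R]_d) (N : set 'rV[R]_d) : nbhs a N ->
  exists2 r : R, 0 < r & cube a r `<=` N.
Proof.
move=> /nbhs_ballP[e /= e0 eN]; exists (e / 2); first by rewrite divr_gt0.
move=> x H; apply: eN; split => // i j; rewrite (ord1 i) /ball /= distrC.
by apply: le_lt_trans (H j) _; rewrite ltr_pdivrMr// ltr_pMr// ltr1n.
Qed.

Lemma cube_compact d (a : 'rV[R]_d) r : compact (cube a r).
Proof.
have -> : cube a r = [set x | forall i, `[a ord0 i - r, a ord0 i + r]%classic (x ord0 i)].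
  apply/seteqP; split => x H i; have := H i; rewrite /= in_itv/= ler_distl//.
have := @rV_compact R d (fun i => `[a ord0 i - r, a ord0 i + r]%classic).
apply=> i; exact: segment_compact.
Qed.

End Bump.

(** * Quadrants and their boundary *)

Section Quadrant.
Context {R : realType}.
Implicit Types X Y Z : tvsType R.

(* Linearly independent functionals are jointly onto R^k: a set of values of
   less than full rank is annihilated by some nonzero column, and the
   corresponding combination of the functionals provides a new value. *)
Lemma independent_onto X k (lam : 'I_k -> {linear X -> R^o}) :
  (forall a : 'I_k -> R, (forall x, \sum_i a i * lam i x = 0) -> forall i, a i = 0) ->
  exists v, forall i, lam i v = 1.
Proof.
move=> ind.
(* [Q A] says that the row space of [A] consists of tuples of values of the functionals. At full
   rank the tuple of ones is among them. *)
pose Q (A : 'M[R]_k) := forall u : 'rV[R]_k, (u <= A)%MS -> exists x, forall i, lam i x = u 0 i.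
have H m : (m <= k)%N -> exists A, Q A /\ (m <= \rank A)%N.
  elim: m => [_|m IH mk].
    exists 0; split => // u; rewrite submx0 => /eqP ->.
    by exists 0 => i; rewrite linear0 mxE.
  have [A [QA mA]] := IH (ltnW mk).
  have [Am|] := ltnP m (\rank A); first by exists A.
  move=> Am; have rA : \rank A = m by apply/eqP; rewrite eqn_leq Am mA.
  have /rowV0Pn[c cA c0] : kermx A^T != 0.
    by rewrite -mxrank_eq0 mxrank_ker mxrank_tr rA -lt0n subn_gt0.
  have {}cA : A *m c^T = 0.
    by apply: trmx_inj; rewrite trmx_mul trmxK trmx0; apply/sub_kermxP.
  have [z cz] : exists z, \sum_i c 0 i * lam i z != 0.
    apply: contrapT => /forallNP nz; move/eqP: c0; apply.
    apply/rowP => i; rewrite mxE; apply: (ind (c 0)) => x.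
    by apply/eqP; apply: contrapT => /negP; exact: nz.
  pose w : 'rV[R]_k := \row_i lam i z.
  have wA : ~~ (w <= A)%MS.
    apply/negP => /submxP[D wD]; move/eqP: cz; apply.
    have : (w *m c^T) 0 0 = 0 by rewrite wD -mulmxA cA mulmx0 mxE.
    by rewrite mxE => H; rewrite -[RHS]H; apply: eq_bigr => i _; rewrite !mxE mulrC.
  exists (A + w)%MS; split.
    move=> u /sub_addsmxP[[u1 u2] /= ->].
    have [x Hx] := QA (u1 *m A) (submxMl _ _).
    exists (x + u2 0 0 *: z) => i; rewrite linearD linearZ Hx [RHS]mxE; congr (_ + _).
    by rewrite [RHS]mxE big_ord1 mxE.
  apply: leq_ltn_trans mA _; apply: rank_ltmx; rewrite ltmxE addsmxSl /=.
  by apply: contra wA; apply: submx_trans; exact: addsmxSr.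
have [A [QA kA]] := H k (leqnn k).
have fA : row_full A by rewrite /row_full eqn_leq kA rank_leq_row.
have [v Hv] := QA (const_mx 1) (submx_full _ fA).
by exists v => i; rewrite Hv mxE.
Qed.

Lemma open_functionals X k (lam : 'I_k -> {linear X -> R^o}) :
  (forall i, continuous (lam i)) -> open [set x | forall i, (0 : R) < lam i x].
Proof.
move=> lc; rewrite openE => x /= lx; apply: filter_forall => i.
exact: (lc i x _ (lt_nbhsr (lx i))).
Qed.

(** A small move along a vector on which every functional equals 1 makes all of them positive, and
    so leads from any point of [C] into the interior. *)
Lemma quadrant_dense_interior X (C W : set X) : is_quadrant C -> open W ->
  dense_interior (C `&` W).
Proof.
move=> [k [lam [lc ind CE]]] oW; apply: dense_interiorI => // x Cx N nN.
have [v Hv] := independent_onto ind.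
have xc : x + h *: v @[h --> (0 : R)^'+] --> x.
  suff : x + h *: v @[h --> (0 : R)^'+] --> x + (0 : R) *: v by rewrite scale0r addr0.
  apply: tcvgD; first exact: cvg_cst.
  apply: tcvgZ; last exact: cvg_cst.
  exact: cvg_at_right_filter.
have [h [/= h0 Nh]] := filter_ex (filterI (nbhs_right_gt (0 : R)) (xc _ nN)).
exists (x + h *: v); split => //.
apply: (@filterS _ _ _ [set x | forall i, (0 : R) < lam i x]).
  by move=> y Hy; rewrite CE => i; exact/ltW/Hy.
apply: open_nbhs_nbhs; split; first exact: open_functionals.
move=> i; rewrite linearD linearZ Hv; apply: ltr_wpDl.
  by move: Cx; rewrite CE; exact.
by rewrite /= /GRing.scale/= mulr1.
Qed.

Lemma dirder_lin X Y Z (f : X -> Y) (l : Y -> Z) x v m : lin l -> continuous l ->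
  dirder f x v m -> dirder (l \o f) x v (l m).
Proof.
move=> [lD lZ] lc df.
have lB a b : l (a - b) = l a - l b by rewrite lD -scaleN1r lZ scaleN1r.
rewrite /dirder /=.
have -> : (fun h : R => h^-1 *: (l (f (x + h *: v)) - l (f x))) =
    (fun h : R => l (h^-1 *: (f (x + h *: v) - f x))).
  by apply/funext => h; rewrite lZ lB.
by apply: continuous_cvg df; exact: lc.
Qed.

(** At a minimum the quotients from the left and from the right have opposite signs. *)
Lemma dirder_min X (f : X -> R^o) x v (l : R) : dirder f x v l ->
  (\forall y \near x, (f x : R) <= f y) -> l = 0.
Proof.
move=> df fmin.
have xc : x + h *: v @[h --> (0 : R)] --> x.
  suff : x + h *: v @[h --> (0 : R)] --> x + (0 : R) *: v by rewrite scale0r addr0.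
  apply: tcvgD; first exact: cvg_cst.
  by apply: tcvgZ; [exact: cvg_id|exact: cvg_cst].
have nmin : \forall h \near (0 : R), (f x : R) <= f (x + h *: v) := xc _ fmin.
apply/eqP; rewrite eq_le; apply/andP; split.
  apply: (cvgr_to_le (cvg_dnbhs_at_left df)); near=> h.
  have h0 : h < 0 by near: h; exact: nbhs_left_lt.
  rewrite /GRing.scale/= nmulr_rle0 ?invr_lt0// subr_ge0.
  by near: h; apply: cvg_at_left_filter nmin; exact: cvg_id.
apply: (cvgr_to_ge (cvg_dnbhs_at_right df)); near=> h.
have h0 : 0 < h by near: h; exact: nbhs_right_gt.
rewrite /GRing.scale/= pmulr_rge0 ?invr_gt0// subr_ge0.
by near: h; apply: cvg_at_right_filter nmin; exact: cvg_id.
Unshelve. all: by end_near. Qed.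

(* If [f x] were a boundary point, some functional [lam i] would be minimal over
   the image of [f] at [f x], so [lam i \o f'] would vanish at [x], and hence so
   would [lam i = lam i \o f' \o g'] by passing to the limit at [f x]. *)
Lemma diffeo_interior X Y (A : set X) (C W : set Y) (f : X -> Y) (g : Y -> X) :
  hausdorff_space Y -> is_quadrant C -> open W ->
  Cn 1 A f -> Cn 1 (C `&` W) g ->
  (forall x, A x -> (C `&` W) (f x)) -> (forall x, A x -> g (f x) = x) ->
  (forall y, (C `&` W) y -> A (g y) /\ f (g y) = y) ->
  forall x, A° x -> (C `&` W)° (f x).
Proof.
move=> hY qC oW [fc [f' [df f'c]]] [gc [g' [dg g'c]]] fB gf gA x Ax.
have dB := quadrant_dense_interior qC oW.
have [k [lam [lc ind CE]]] := qC.
have ll i : lin (lam i : Y -> R^o) by split => [a b|c a]; rewrite ?linearD ?linearZ.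
have fxB := fB x (interior_subset Ax).
apply: contrapT => nB.
have [i li0] : exists i, lam i (f x) = 0.
  apply: contrapT => /forallNP nl; apply: nB.
  rewrite interiorI; split; last by move: oW => /interior_id ->; have [] := fxB.
  apply: (@filterS _ _ _ [set x | forall i, (0 : R) < lam i x]).
    by move=> y Hy; rewrite CE => i; exact/ltW/Hy.
  apply: open_nbhs_nbhs; split; first exact: open_functionals.
  move=> i; rewrite lt_neqAle eq_sym; apply/andP; split; first exact/eqP/nl.
  by have [+ _] := fxB; rewrite CE; exact.
have lf' v : lam i (f' (x, v)) = 0.
  apply: (dirder_min (dirder_lin (ll i) (lc i) (df x v Ax))).
  apply: filterS Ax => y Ay /=; rewrite li0.
  by have [+ _] := fB y Ay; rewrite CE; exact.
have [v Hv] := independent_onto ind.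
(* Only over [B1], where [g] takes values in the interior of [A], does [f'] give genuine
   derivatives. The point [f x] belongs to it because [g (f x) = x], and is a limit of points of
   [B1] interior to [B], where the chain rule for [f \o g = id] applies. *)
pose B := C `&` W; pose B1 := B `&` g @^-1` A°.
have gfx : g (f x) = x by apply: gf; exact: interior_subset.
have key : lam i (f' (g (f x), g' (f x, v))) = lam i v.
  apply: (@cts_closure_eq _ R^o B1 (B1 `&` B°)
    (fun y => lam i (f' (g y, g' (y, v)))) (fun=> lam i v)).
  - exact: Rhausdorff.
  - apply: (@cts_comp _ _ _ _ (A° `*` setT) (fun y => (g y, g' (y, v)))
      (fun p => lam i (f' p))).
    + by move=> y [_].
    + apply: cts_pair; first by apply: cts_sub gc => y [].
      apply: (@cts_comp _ _ _ _ (B `*` setT) (fun y => (y, v)) g') => //.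
        by move=> y [].
      by apply: continuous_cts => y; apply: cvg_pair; [exact: cvg_id|exact: cvg_cst].
    + apply: (@cts_comp _ _ _ _ setT f' (lam i)) => //.
        by apply: cts_sub f'c => p [/interior_subset].
      exact: continuous_cts.
  - by apply: continuous_cts => y; exact: cvg_cst.
  - by move=> y [].
  - move=> y [[By Agy] Biy]; congr (lam i _).
    have d1 : dirder (f \o g) y v (f' (g y, g' (y, v))).
      apply: dirder_comp; first exact: dg.
        by apply: filterS (open_nbhs_nbhs (conj (open_interior A) Agy)) => z Az w;
          exact: df.
      by apply: cts_interior f'c _; rewrite interior_setX.
    have d2 : dirder id y v v.
      apply: cvg_near_cst; near=> h.
      have h0 : h != 0 by near: h; exact: nbhs_dnbhs_neq.
      by rewrite addrC addKr scalerA mulVf// scale1r.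
    apply: (dirder_unique hY _ d2); apply: dirder_near d1.
    by apply: filterS Biy => z /gA[].
  - by split => //=; rewrite gfx.
  - move=> N nN.
    have := gc (f x) fxB A°; rewrite gfx => /(_ (nbhs_interior Ax)).
    rewrite /nbhs/= /within/= => nA.
    have [y [Biy [Ny Ay]]] := dB (f x) fxB _ (filterI nN nA).
    by exists y; split => //; split => //; split;
      [exact: interior_subset|exact: (Ay (interior_subset Biy))].
move: key; rewrite gfx lf' Hv => /eqP; rewrite eq_sym.
by rewrite oner_eq0.
Unshelve. all: by end_near. Qed.

Lemma orthant_quadrant d : is_quadrant (@orthant R d).
Proof.
pose lam (i : 'I_d) (x : 'rV[R]_d) : R^o := x ord0 i.
have lin_lam i : linear (lam i) by move=> c x y; rewrite /lam !mxE.
pose Lam i : {linear 'rV[R]_d -> R^o} :=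
  HB.pack (lam i) (GRing.isLinear.Build _ _ _ _ (lam i) (lin_lam i)).
exists d, Lam; split.
- by move=> i; exact: coord_continuous.
- move=> a H i; have := H (delta_mx ord0 i).
  rewrite (bigD1 i)//= /lam mxE !eqxx mulr1 big1 ?addr0// => j ji.
  by rewrite mxE (negPf ji) andbF mulr0.
- by [].
Qed.

End Quadrant.

(** * Charts *)

Section Charts.
Context {R : realType}.
Implicit Types (S T : topologicalType) (X Y : tvsType R).

Lemma open_preim_cts S T (D : set S) (f : S -> T) (G : set T) :
  open D -> cts D f -> open G -> open (D `&` f @^-1` G).
Proof.
move=> oD fc oG; rewrite openE => x [Dx Gx]; apply: filterI.
  exact: open_nbhs_nbhs.
apply: (cts_interior fc) => //; last exact: open_nbhs_nbhs.
exact: open_nbhs_nbhs.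
Qed.

Section OneChart.
Variables (T : topologicalType) (X : tvsType R) (C : set X) (c : chart T X).
Hypothesis cC : is_chart C c.

Lemma chart_hausdorff : hausdorff_space X. Proof. by case: cC. Qed.

Lemma chart_open : open (cdom c). Proof. by case: cC. Qed.

Lemma chart_cfun_cts : cts (cdom c) (cfun c).
Proof. by case: cC => _ _ [/ctsP]. Qed.

Lemma chart_cinv_cts : cts (cfun c @` cdom c) (cinv c).
Proof. by case: cC => _ _ [_ /ctsP]. Qed.

Lemma chartK x : cdom c x -> cinv c (cfun c x) = x.
Proof. by case: cC => _ _ _ + _; exact. Qed.

Lemma chart_image G x : cdom c x -> (cfun c @` (cdom c `&` G)) (cfun c x) -> G x.
Proof. by move=> cx [y [cy Gy] /(congr1 (cinv c))]; rewrite !chartK// => <-. Qed.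

Lemma chart_image_open G : open G ->
  exists2 W, open W & cfun c @` (cdom c `&` G) = C `&` W.
Proof.
move=> oG; have [_ _ _ _ [W0 oW0 cW0]] := cC.
(* The implication makes this set a neighbourhood in the whole of [X] of each point of the image,
   although [cinv c] is continuous only within the image. *)
pose W := W0 `&` [set y | (cfun c @` cdom c) y -> G (cinv c y)]°.
exists W; first by apply: openI => //; exact: open_interior.
apply/seteqP; split => [_ [x [cx Gx] <-]|y [Cy [W0y Gy]]].
  have : (C `&` W0) (cfun c x) by rewrite -cW0; exists x.
  case=> Cx W0x; split => //; split => //.
  have cc : (cfun c @` cdom c) (cfun c x) by exists x.
  have := chart_cinv_cts cc; rewrite chartK// => /(_ G (open_nbhs_nbhs (conj oG Gx))).
  by [].
have [x cx xy] : (cfun c @` cdom c) y by rewrite cW0.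
exists x => //; split => //.
have := interior_subset Gy; rewrite -xy /= => H.
by rewrite -(chartK cx); apply: H; exists x.
Qed.

End OneChart.

Lemma prod_chart_is_chart S T X Y (C : set X) (C' : set Y)
    (c : chart S X) (c' : chart T Y) : is_chart C c -> is_chart C' c' ->
  is_chart (C `*` C') (prod_chart c c').
Proof.
move=> hc hc'.
have imE : cfun (prod_chart c c') @` cdom (prod_chart c c') =
    (cfun c @` cdom c) `*` (cfun c' @` cdom c').
  apply/seteqP; split => [_ [[x y] [/= cx cy] <-]|[a b] [/= [x cx <-] [y cy <-]]].
    by split; [exists x|exists y].
  by exists (x, y).
split.
- by apply: hausdorff_setX; [exact: chart_hausdorff hc|exact: chart_hausdorff hc'].
- by apply: open_setX; [exact: chart_open hc|exact: chart_open hc'].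
- split; apply/ctsP; rewrite ?imE.
  + apply: cts_pair.
      apply: (@cts_comp _ _ _ _ (cdom c) fst (cfun c)) => [[x y] [] //||].
        by apply: continuous_cts; exact: continuous_fst.
      exact: chart_cfun_cts hc.
    apply: (@cts_comp _ _ _ _ (cdom c') snd (cfun c')) => [[x y] [] //||].
      by apply: continuous_cts; exact: continuous_snd.
    exact: chart_cfun_cts hc'.
  + apply: cts_pair.
      apply: (@cts_comp _ _ _ _ (cfun c @` cdom c) fst (cinv c)) => [[x y] [] //||].
        by apply: continuous_cts; exact: continuous_fst.
      exact: chart_cinv_cts hc.
    apply: (@cts_comp _ _ _ _ (cfun c' @` cdom c') snd (cinv c')) => [[x y] [] //||].
      by apply: continuous_cts; exact: continuous_snd.
    exact: chart_cinv_cts hc'.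
- by move=> [x y] [/= cx cy]; rewrite (chartK hc) ?(chartK hc').
- have [_ _ _ _ [W oW cW]] := hc; have [_ _ _ _ [W' oW' cW']] := hc'.
  exists (W `*` W'); first exact: open_setX.
  by rewrite imE cW cW'; apply/seteqP; split => [[a b] [[? ?] [? ?]]|[a b] [[? ?] [? ?]]].
Qed.

Lemma smooth_open_Cn n X Y (A : set X) (f : X -> Y) : hausdorff_space Y -> open A ->
  smooth_open A f -> Cn n A f.
Proof.
move=> hY oA fA; apply: smooth_dom_Cn => //.
have iA : A° = A by apply/interior_id.
split.
- have [_ /(_ 0%N (leqnn _))/ctsP fc] := fA 0%N.
  exact/ctsP.
- by rewrite iA.
- by move=> k; exists (dn (n := k) f); split => //; exact: (fA k).2 k (leqnn k).
Qed.

(** Different points may have different local extensions; their restrictions to [A] are of class C^n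
    and are glued by [Cn_local]. *)
Lemma smooth_ext_Cn n m k (A : set 'rV[R]_m) (f : 'rV[R]_m -> 'rV[R]_k) :
  dense_interior A -> smooth_ext A f -> Cn n A f.
Proof.
move=> dA fA; apply: Cn_local => //.
move=> x Ax; have [U [g [oU Ux gU fg]]] := fA x Ax; exists U; split => //.
apply: (@Cn_eq _ _ _ _ _ g); first by move=> y [Ay Uy]; exact: fg.
apply: (@Cn_sub _ _ _ _ U); first by move=> y [].
exact: smooth_open_Cn.
Qed.

End Charts.

(** * Pointwise smoothness of maps from M to E *)

Section SmoothAt.
Context {R : realType} (d : nat) (M E : topologicalType).
Variables (AM : set (chart M 'rV[R]_d)) (AE : @atlas R E).
Hypothesis hM : fd_manifold_corners AM.
Hypothesis hE : lc_manifold_corners AE.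

Lemma fd_chart c : AM c -> is_chart (@orthant R d) c.
Proof. by case: hM => _ _ + _ _; exact. Qed.

Lemma fd_image_dense c G : AM c -> open G -> dense_interior (cfun c @` (cdom c `&` G)).
Proof.
move=> Ac oG; have [W oW ->] := chart_image_open (fd_chart Ac) oG.
by apply: quadrant_dense_interior => //; exact: orthant_quadrant.
Qed.

Lemma fd_transition n c c' G : AM c -> AM c' -> open G ->
  Cn n (cfun c @` (cdom c `&` (cdom c' `&` G))) (cfun c' \o cinv c).
Proof.
move=> Ac Ac' oG; apply: (@Cn_sub _ _ _ _ (cfun c @` (cdom c `&` cdom c'))).
  by move=> _ [x [cx [c'x _]] <-]; exists x.
apply: smooth_ext_Cn; first by apply: fd_image_dense => //; exact: chart_open (fd_chart Ac').
by case: hM => _ _ _ _; exact.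
Qed.

Lemma fd_transition_interior c c' G : AM c -> AM c' -> open G ->
  forall a, (cfun c @` (cdom c `&` (cdom c' `&` G)))° a ->
  (cfun c' @` (cdom c' `&` (cdom c `&` G)))° ((cfun c' \o cinv c) a).
Proof.
move=> Ac Ac' oG; have hc := fd_chart Ac; have hc' := fd_chart Ac'.
have [W oW WE] := chart_image_open hc' (openI (chart_open hc) oG).
rewrite WE; apply: (@diffeo_interior _ _ _ _ _ _ _ (cfun c \o cinv c')) => //.
- exact: orthant_quadrant.
- exact: fd_transition.
- by rewrite -WE; exact: fd_transition.
- by move=> _ [x [cx [c'x Gx]] <-]; rewrite -WE /= (chartK hc)//; exists x.
- by move=> _ [x [cx [c'x Gx]] <-]; rewrite /= (chartK hc)// (chartK hc').
- rewrite -WE => _ [x [c'x [cx Gx]] <-]; rewrite /= (chartK hc')//.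
  by rewrite (chartK hc)//; split => //; exists x.
Qed.

Definition smooth_at (tau : M -> E) (x : M) :=
  exists W, [/\ open W, W x & smooth_on (fd_atlas AM) AE W tau].

Lemma smooth_on_Cn (tau : M -> E) W n c X (c' : chart E X) :
  smooth_on (fd_atlas AM) AE W tau -> AM c -> AE c' ->
  Cn n (cfun c @` (W `&` cdom c `&` tau @^-1` cdom c')) (cfun c' \o tau \o cinv c).
Proof.
move=> [_ H] Ac Ac'; apply: smooth_dom_Cn; last by apply: H => //; exact: FdAtlas.
have [_ hc _ _] := hE; have [C _ hc'] := hc _ _ Ac'.
exact: chart_hausdorff hc'.
Qed.

Lemma Cn_smooth_on (tau : M -> E) W : cts W tau ->
  (forall n c X (c' : chart E X), AM c -> AE c' ->
  Cn n (cfun c @` (W `&` cdom c `&` tau @^-1` cdom c')) (cfun c' \o tau \o cinv c)) ->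
  smooth_on (fd_atlas AM) AE W tau.
Proof.
move=> tc H; split; first exact/ctsP.
move=> X c Y c' [c0 Ac0] Ac'; apply: Cn_smooth_dom; last by move=> n; exact: H.
have [_ hc _ _] := hE; have [C _ hc'] := hc _ _ Ac'.
exact: chart_hausdorff hc'.
Qed.

Lemma smooth_at_eq (tau tau' : M -> E) x : continuous tau' ->
  (\forall y \near x, tau y = tau' y) -> smooth_at tau x -> smooth_at tau' x.
Proof.
move=> tc eqx; have : nbhs x [set y | tau y = tau' y] := eqx.
rewrite nbhsE => -[W' [oW' W'x] eW'] [W [oW Wx Wt]].
exists (W `&` W'); split => //; first exact: openI.
apply: Cn_smooth_on; first exact: continuous_cts.
move=> n c X c' Ac Ac'; have hc := fd_chart Ac.
apply: (@Cn_eq _ _ _ _ _ (cfun c' \o tau \o cinv c)).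
  by move=> _ [y [[[Wy W'y] cy] c'y] <-]; rewrite /= (chartK hc)// eW'.
apply: Cn_sub (smooth_on_Cn n Wt Ac Ac').
move=> _ [y [[[Wy W'y] cy] c'y] <-]; exists y => //; split => //.
by rewrite /preimage /= eW'.
Qed.

(** The points at which [tau] is smooth form an open set, which serves as the neighbourhood. On it,
    smoothness in a pair of charts is assembled by [Cn_local], the chart image of an open set having
    dense interior. *)
Lemma smooth_near_at (tau : M -> E) (L : set M) : continuous tau ->
  (forall x, L x -> smooth_at tau x) -> smooth_near (fd_atlas AM) AE L tau.
Proof.
move=> tc H; pose W := [set x | smooth_at tau x].
have oW : open W.
  rewrite openE => x [W' [oW' W'x W't]].
  apply: filterS (open_nbhs_nbhs (conj oW' W'x)) => y W'y.
  by exists W'.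
exists W; first by split.
apply: Cn_smooth_on; first exact: continuous_cts.
move=> n c X c' Ac Ac'; have hc := fd_chart Ac.
have [_ hcE _ _] := hE; have [C _ hc'] := hcE _ _ Ac'.
apply: Cn_local; first exact: chart_hausdorff hc'.
  have -> : W `&` cdom c `&` tau @^-1` cdom c' = cdom c `&` (W `&` tau @^-1` cdom c').
    by rewrite setIAC setIC.
  apply: fd_image_dense => //; apply: openI => //.
  by apply: open_comp (chart_open hc') => y _; exact: tc.
move=> _ [x [[[W' [oW' W'x W't]] cx] c'x] <-].
have [V oV VE] := chart_image_open hc oW'.
exists V; split => //.
  have : (orthant (d:=d) `&` V) (cfun c x) by rewrite -VE; exists x.
  by case.
apply: Cn_sub (smooth_on_Cn n W't Ac Ac').
move=> _ [[y [[Wy cy] c'y] <-] Vy]; exists y => //; split => //; split => //.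
apply: (chart_image hc cy); rewrite VE; split => //.
have [_ _ _ _ [W0 _ W0E]] := hc.
have : (orthant (d:=d) `&` W0) (cfun c y) by rewrite -W0E; exists y.
by case.
Qed.

End SmoothAt.

(** * Sections in bundle charts *)

Section Bundle.
Context {R : realType} (d : nat) (M N E : topologicalType).
Variables (AM : set (chart M 'rV[R]_d)) (AN : @atlas R N) (AE : @atlas R E).
Variables (pi : E -> M) (U : set M) (phi : E -> M * N) (psi : M * N -> E).
Hypothesis hM : fd_manifold_corners AM.
Hypothesis hN : lc_manifold AN.
Hypothesis hE : lc_manifold_corners AE.
Hypothesis pic : continuous pi.
Hypothesis oU : open U.
Hypothesis hphi : diffeo_on AE (prod_atlas (fd_atlas AM) AN)
  (pi @^-1` U) (U `*` setT) phi psi.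
Hypothesis phi1 : forall e, U (pi e) -> (phi e).1 = pi e.
Variables (Y : tvsType R) (c : chart M 'rV[R]_d) (eta : chart N Y).
Hypothesis Ac : AM c.
Hypothesis Aeta : AN eta.

Lemma psiK z : U z.1 -> phi (psi z) = z.
Proof. by case: hphi => _ _ _ H Uz; have [] := H z (conj Uz I). Qed.

Lemma phiK e : U (pi e) -> psi (phi e) = e.
Proof. by case: hphi => _ _ H _ Ue; have [] := H e Ue. Qed.

Lemma pi_psi z : U z.1 -> pi (psi z) = z.1.
Proof.
move=> Uz; have [_ _ _ H] := hphi; have [Up] := H z (conj Uz I).
by rewrite -phi1// psiK.
Qed.

Lemma phi_cts : cts (pi @^-1` U) phi.
Proof. by case: hphi => -[/ctsP]. Qed.

Lemma psi_cts : cts (U `*` setT) psi.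
Proof. by case: hphi => _ [/ctsP]. Qed.

Lemma fib_chart : is_chart setT eta.
Proof. by case: hN => _ + _ _; exact. Qed.

Let hc : is_chart (@orthant R d) c. Proof. exact: fd_chart Ac. Qed.

Let kap := prod_chart c eta.

Let hkap : is_chart (@orthant R d `*` setT) kap.
Proof. by apply: prod_chart_is_chart => //; exact: fib_chart. Qed.

Lemma open_pre_U : open (pi @^-1` U).
Proof. by apply: open_comp => // e _; exact: pic. Qed.

Definition fib_coord (tau : M -> E) (x : M) : Y := cfun eta (phi (tau x)).2.

(** The fibre has no boundary, so the base component alone decides whether a point is interior. *)
Lemma interior_cylinder (S T : topologicalType) (O : set S) (W : set (S * T)%type) x :
  open W -> (O `*` [set: T] `&` W) x -> O° x.1 -> (O `*` setT `&` W)° x.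
Proof.
move=> oW [_ Wx] Ox; rewrite interiorI interior_setX; split => //.
by move: oW => /interior_id ->.
Qed.

Section Target.
Variables (X : tvsType R) (c' : chart E X).
Hypothesis Ac' : AE c'.

Let D := cfun kap @` (U `*` setT `&` cdom kap `&` psi @^-1` cdom c').
Let B := cfun c' @` (pi @^-1` U `&` cdom c' `&` phi @^-1` cdom kap).

Lemma target_chart : exists2 C, is_quadrant C & is_chart C c'.
Proof. by case: hE => _ + _ _; exact. Qed.

Lemma dom_psi : exists2 W, open W & D = @orthant R d `*` setT `&` W.
Proof.
have [C _ hc'] := target_chart.
have [|W oW WE] := @chart_image_open _ _ _ _ _ hkap (U `*` setT `&` psi @^-1` cdom c').
  apply: open_preim_cts (chart_open hc'); last exact: psi_cts.
  by apply: open_setX => //; exact: openT.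
by exists W => //; rewrite /D -WE setIAC [X in _ @` X]setIC.
Qed.

Lemma Cn_psi n : Cn n D (cfun c' \o psi \o cinv kap).
Proof.
have [C _ hc'] := target_chart.
apply: smooth_dom_Cn; first exact: chart_hausdorff hc'.
by case: hphi => _ [_ H] _ _; apply: H => //; apply: ProdAtlas.
Qed.

Lemma Cn_phi n : Cn n B (cfun kap \o phi \o cinv c').
Proof.
apply: smooth_dom_Cn; first exact: chart_hausdorff hkap.
by case: hphi => [[_ H]] _ _ _; apply: H => //; apply: ProdAtlas.
Qed.

Lemma psi_interior a : D° a -> B° ((cfun c' \o psi \o cinv kap) a).
Proof.
have [C qC hc'] := target_chart.
have [|W oW WE] := @chart_image_open _ _ _ _ _ hc' (pi @^-1` U `&` phi @^-1` cdom kap).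
  apply: open_preim_cts (chart_open hkap); last exact: phi_cts.
  exact: open_pre_U.
have BE : B = C `&` W by rewrite /B -WE setIAC [X in _ @` X]setIC.
rewrite BE; apply: (@diffeo_interior _ _ _ _ _ _ _ (cfun kap \o phi \o cinv c')) => //.
- exact: chart_hausdorff hc'.
- exact: Cn_psi.
- by rewrite -BE; exact: Cn_phi.
- move=> _ [z [[[Uz _] kz] cz] <-]; rewrite -BE /comp (chartK hkap kz); exists (psi z) => //.
  split; first by split => //; rewrite /preimage/= pi_psi.
  by rewrite /preimage /= psiK.
- move=> _ [z [[[Uz _] kz] cz] <-].
  by rewrite /comp (chartK hkap kz) (chartK hc' cz) psiK.
- rewrite -BE => _ [e [[Ue ce] ke] <-].
  rewrite /comp (chartK hc' ce); split; last by rewrite (chartK hkap ke) phiK.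
  exists (phi e) => //; split; last by rewrite /preimage /= phiK.
  by split => //; split => //; rewrite phi1.
Qed.

End Target.

(** The fibre coordinate comes from [phi] in charts after [tau] in charts, and the chain rule needs
    [tau] to send interior points to interior points in a chart of [E]. As [tau] is [psi] of its own
    coordinates, this is [psi_interior] at a point whose base component is interior. *)
Lemma coord_of_smooth tau x : continuous tau -> is_section pi tau ->
  smooth_at AM AE tau x -> U x -> cdom c x -> cdom eta (phi (tau x)).2 ->
  exists W, [/\ open W, W x, W `<=` U `&` cdom c,
    (forall y, W y -> cdom eta (phi (tau y)).2) &
    forall n, Cn n (cfun c @` W) (fib_coord tau \o cinv c)].
Proof.
move=> tc ts [W0 [oW0 W0x W0t]] Ux cx ex.
have [_ _ covE _] := hE; have [X [c' [Ac' c'x]]] := covE (tau x).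
have [C qC hc'] := target_chart Ac'.
pose G := (pi @^-1` U `&` phi @^-1` cdom kap) `&` cdom c'.
have oG : open G.
  apply: openI; last exact: chart_open hc'.
  apply: open_preim_cts (chart_open hkap); last exact: phi_cts.
  exact: open_pre_U.
pose W := W0 `&` cdom c `&` tau @^-1` G.
have WP y : W y -> [/\ W0 y, cdom c y, U y, cdom eta (phi (tau y)).2 & cdom c' (tau y)].
  by move=> [[? ?] [[+ []]]]; rewrite /preimage/= ts.
exists W; split.
- apply: openI; first by apply: openI => //; exact: chart_open hc.
  by apply: open_comp oG => y _; exact: tc.
- split => //; split => //; rewrite /preimage /= ts; split => //; split => //.
  by rewrite /= phi1 ts.
- by move=> y /WP[].
- by move=> y /WP[].
move=> n; have [WD oWD DE] := dom_psi Ac'.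
pose A := cfun c @` W.
have Aorth a : A° a -> (@orthant R d)° a.
  apply: interiorS => _ [y /WP[_ cy _ _ _] <-].
  have [_ _ _ _ [V _ VE]] := hc.
  have : (orthant (d:=d) `&` V) (cfun c y) by rewrite -VE; exists y.
  by case.
have S1 : Cn n A ((cfun kap \o phi \o cinv c') \o (cfun c' \o tau \o cinv c)).
  apply: Cn_comp (Cn_phi Ac' n).
  - move=> _ [y /WP[W0y cy Uy ey c'y] <-]; rewrite /= (chartK hc cy).
    by exists (tau y) => //; rewrite phi1 ts.
  - move=> a Aa; have [y /WP[W0y cy Uy ey c'y] ya] := interior_subset Aa.
    have zE : phi (tau y) = (y, (phi (tau y)).2).
      by rewrite {1}[phi (tau y)]surjective_pairing phi1 ts.
    have -> : (cfun c' \o tau \o cinv c) a =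
        (cfun c' \o psi \o cinv kap) (a, fib_coord tau y).
      rewrite -ya /= (chartK hc cy) /fib_coord (chartK fib_chart ey) -zE phiK ?ts//.
    apply: psi_interior => //; rewrite DE; apply: interior_cylinder => //.
      rewrite -DE; exists (y, (phi (tau y)).2); last by rewrite -ya.
      by split => //; rewrite /preimage /= -zE phiK ?ts.
    exact: Aorth.
  - apply: Cn_sub (smooth_on_Cn hE n W0t Ac Ac').
    by move=> _ [y /WP[W0y cy Uy ey c'y] <-]; exists y.
have := @Cn_compT _ _ _ _ _ _ _ snd S1 (Cn_lin _ _ _ _).
move=> /(_ (conj (fun _ _ => erefl) (fun _ _ => erefl)) (@continuous_snd _ _)).
apply: Cn_eq => _ [y /WP[W0y cy Uy ey c'y] <-]; rewrite /= (chartK hc cy).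
by rewrite (chartK hc' c'y).
Qed.

(** [tau] is [psi] applied to the base point and the fibre coordinate. Since smoothness is tested in
    every chart of [M], the change of charts [tr] is composed in front. *)
Lemma smooth_of_coord tau W : continuous tau -> is_section pi tau ->
  open W -> W `<=` U -> W `<=` cdom c -> (forall y, W y -> cdom eta (phi (tau y)).2) ->
  (forall n, Cn n (cfun c @` W) (fib_coord tau \o cinv c)) ->
  smooth_on (fd_atlas AM) AE W tau.
Proof.
move=> tc ts oW WU Wc We SW.
apply: Cn_smooth_on => //; first exact: continuous_cts.
move=> n c1 X c' Ac1 Ac'; have hc1 := fd_chart hM Ac1.
have [C qC hc'] := target_chart Ac'.
have [WD oWD DE] := dom_psi Ac'.
pose A := cfun c1 @` (cdom c1 `&` (cdom c `&` (W `&` tau @^-1` cdom c'))).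
have oG : open (W `&` tau @^-1` cdom c').
  by apply: openI => //; apply: open_comp (chart_open hc') => y _; exact: tc.
have AE' : cfun c1 @` (W `&` cdom c1 `&` tau @^-1` cdom c') = A.
  apply/seteqP; split => [a [y]|a [y]].
    by move=> [[Wy cy] c'y] <-; exists y => //; split => //; split => //; exact: Wc.
  by move=> [cy [_ [Wy c'y]]] <-; exists y.
rewrite AE'.
pose tr := cfun c \o cinv c1.
have zE y : W y -> phi (tau y) = (y, (phi (tau y)).2).
  by move=> Wy; rewrite {1}[phi (tau y)]surjective_pairing phi1 ts//; exact: WU.
pose F a := (tr a, (fib_coord tau \o cinv c) (tr a)).
have FD a : A a -> (cfun kap @` (U `*` setT `&` cdom kap `&` psi @^-1` cdom c')) (F a).
  move=> [y [cy [c0y [Wy c'y]]] <-].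
  exists (y, (phi (tau y)).2).
    split; first by split; [split => //; exact: WU|split => //; exact: We].
    by rewrite /preimage /= -zE// phiK// ts; exact: WU.
  by rewrite /F /tr /= (chartK hc1 cy) (chartK hc c0y).
have trA a : A° a -> (cfun c @` W)° (tr a).
  move=> /(fd_transition_interior hM Ac1 Ac oG); apply: interiorS.
  by move=> _ [y [_ [_ [Wy _]]] <-]; exists y.
have SF : Cn n A F.
  have Str : Cn n A tr by exact: (fd_transition hM n Ac1 Ac oG).
  apply: Cn_pair => //.
  apply: Cn_comp (SW n) => //.
    move=> _ [y [cy [c0y [Wy c'y]]] <-]; exists y => //.
    by rewrite /tr /= (chartK hc1 cy).
apply: (@Cn_eq _ _ _ _ _ ((cfun c' \o psi \o cinv kap) \o F)).
  move=> _ [y [cy [c0y [Wy c'y]]] <-].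
  rewrite /F /tr /= (chartK hc1 cy) (chartK hc c0y) /fib_coord.
  by rewrite (chartK fib_chart (We y Wy)) -zE// phiK// ts; exact: WU.
apply: Cn_comp (Cn_psi Ac' n) => // a Aa.
rewrite DE; apply: interior_cylinder => //; first by rewrite -DE; apply: FD; exact: interior_subset.
apply: (@interiorS _ (cfun c @` W)); last exact: trA.
move=> _ [y Wy <-].
have [_ _ _ _ [V _ VE]] := hc.
have : (orthant (d:=d) `&` V) (cfun c y) by rewrite -VE; exists y => //; exact: Wc.
by case.
Qed.

End Bundle.

(** * Locally finite covers *)

Section Topology.
Implicit Types T : topologicalType.

Lemma compact_seq_cover T (I : eqType) (D : set I) (f : I -> set T) (K : set T) :
  compact K -> (forall x, K x -> exists2 i, D i & open (f i) /\ f i x) ->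
  exists2 l : seq I, (forall i, i \in l -> D i) &
    forall x, K x -> exists2 i, i \in l & f i x.
Proof.
move=> /compact_near_coveringP cK Kf.
(* The filter of finite lists ordered by inclusion: a property holds eventually if it holds for all
   lists containing a fixed list of indices from [D]. *)
pose F : set_system (seq I) := [set A | exists2 l0 : seq I, (forall i, i \in l0 -> D i) &
  forall l : seq I, {subset l0 <= l} -> A l].
have FF : Filter F.
  split.
  - by exists [::].
  - move=> P Q [l0 D0 P0] [l1 D1 Q1]; exists (l0 ++ l1).
      by move=> i; rewrite mem_cat => /orP[/D0|/D1].
    move=> l sl; split; [apply: P0|apply: Q1] => i il; apply: sl;
      by rewrite mem_cat il ?orbT.
  - by move=> P Q PQ [l0 D0 P0]; exists l0 => // l /P0/PQ.
have [|l Dl Hl] := cK (seq I) F (fun l x => exists2 i, i \in l & f i x) FF.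
  move=> x Kx; have [i Di [oi fx]] := Kf x Kx.
  exists (f i, [set l : seq I | i \in l]).
    split; first exact: open_nbhs_nbhs.
    exists [:: i]; first by move=> j; rewrite inE => /eqP ->.
    by move=> l; apply; rewrite inE.
  by move=> [y l] [/= fy il]; exists i.
by exists l => // x Kx; exact: Hl.
Qed.

Lemma lf_closed T (I : choiceType) (J : set I) (F : I -> set T) :
  (forall i, J i -> closed (F i)) ->
  (forall x : T, exists2 N, nbhs x N & finite_set [set i | J i /\ F i `&` N !=set0]) ->
  closed (\bigcup_(i in J) F i).
Proof.
move=> cF lf x clx; have [N nN fN] := lf x.
pose S := [set i | J i /\ F i `&` N !=set0].
have cS : closed (\bigcup_(i in S) F i).
  by apply: closed_bigcup => // i [Ji _]; exact: cF.
have [i [Ji _] Fx] : (\bigcup_(i in S) F i) x.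
  apply: cS => B nB; have [y [[i Ji Fy] [By Ny]]] := clx _ (filterI nB nN).
  by exists y; split => //; exists i => //; split => //; exists y.
by exists i.
Qed.

Definition loc_finite T (V : set (set T)) :=
  forall x : T, exists2 W, nbhs x W & finite_set [set B | V B /\ B `&` W !=set0].

Lemma loc_finite_closure T (V : set (set T)) (x : T) : loc_finite V ->
  exists2 W, open_nbhs x W & finite_set [set B | V B /\ closure B `&` W !=set0].
Proof.
move=> /(_ x)[N nN fN]; exists N°.
  by split; [exact: open_interior|exact: nN].
apply: sub_finite_set fN => B [VB [y [cBy Ny]]]; split => //.
have [z [Bz Nz]] := cBy _ Ny.
by exists z.
Qed.

Definition locally_regular T := forall (x : T) (G : set T), open G -> G x ->
  exists P, [/\ open P, P x & closure P `<=` G].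

(* Shrinking lemma: [K B] is the union of the closures, contained in [B], of the
   members of a finer locally finite cover. *)
Lemma shrink_cover T (good : set T -> Prop) : paracompact T -> locally_regular T ->
  (forall B B', B `<=` B' -> good B' -> good B) ->
  (forall x, exists P, [/\ open P, P x & good P]) ->
  exists (V : set (set T)) (K : set T -> set T),
    [/\ forall B, V B -> open B /\ good B,
        forall B, V B -> closed (K B) /\ K B `<=` B,
        forall x, exists2 B, V B & K B x & loc_finite V].
Proof.
move=> pT rT goodS goodx.
have [||V [Vo Vc Vr Vf]] := pT [set P | open P /\ good P].
- by move=> P [].
- apply/seteqP; split => // x _; have [P [oP Px gP]] := goodx x.
  by exists P.
have [||W [Wo Wc Wr Wf]] := pT [set P | open P /\ exists2 B, V B & closure P `<=` B].
- by move=> P [].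
- apply/seteqP; split => // x _.
  have [B VB Bx] : (\bigcup_(B in V) B) x by rewrite Vc.
  have [P [oP Px PB]] := rT x B (Vo B VB) Bx.
  by exists P => //; split => //; exists B.
exists V, (fun B => \bigcup_(P in [set P | W P /\ closure P `<=` B]) closure P).
split => //.
- by move=> B VB; split; [exact: Vo|have [B' [_ gB'] BB'] := Vr B VB; exact: goodS gB'].
- move=> B VB; split; last by move=> x [P [_ PB]]; exact: PB.
  apply: lf_closed; first by move=> P _; exact: closed_closure.
  move=> x; have [N [oN Nx] fN] := loc_finite_closure x Wf.
  exists N; first exact: open_nbhs_nbhs.
  by apply: sub_finite_set fN => P [[WP _] PN].
- move=> x; have [P WP Px] : (\bigcup_(P in W) P) x by rewrite Wc.
  have [P' [_ [B VB P'B]] PP'] := Wr P WP.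
  exists B => //; exists P; last exact: subset_closure.
  by split => //; apply: subset_trans P'B; exact: closure_subset.
Qed.

End Topology.

(** * Compact cells in the charts of M *)

Section LocCompact.
Context {R : realType} (d : nat) (M : topologicalType).
Variables (AM : set (chart M 'rV[R]_d)).
Hypothesis hM : fd_manifold_corners AM.

Lemma orthant_closed : closed (@orthant R d).
Proof.
have -> : @orthant R d = \bigcap_i ((fun x : 'rV[R]_d => x ord0 i) @^-1` [set r | 0 <= r]).
  by apply/seteqP; split => [x H i _|x H i]; [exact: H|exact: H i I].
apply: closed_bigI => i _; apply: closed_comp; last exact: closed_ge.
by move=> x _; exact: coord_continuous.
Qed.

Lemma chart_cube c x G : AM c -> cdom c x -> open G -> G x ->
  exists2 r, 0 < r & cube (cfun c x) r `&` @orthant R d `<=` cfun c @` (cdom c `&` G).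
Proof.
move=> Ac cx oG Gx; have [W oW WE] := chart_image_open (fd_chart hM Ac) oG.
have Wx : (@orthant R d `&` W) (cfun c x) by rewrite -WE; exists x.
have [r r0 rW] := cube_sub (open_nbhs_nbhs (conj oW Wx.2)).
by exists r => // y [/rW Wy Oy]; rewrite WE.
Qed.

Definition chart_cell (c : chart M 'rV[R]_d) a r :=
  cinv c @` (cube a r `&` @orthant R d).

Lemma chart_cell_compact c a r : AM c ->
  cube a r `&` @orthant R d `<=` cfun c @` cdom c -> compact (chart_cell c a r).
Proof.
move=> Ac sub; apply: continuous_compact.
  apply/ctsP; apply: cts_sub sub _.
  exact: chart_cinv_cts (fd_chart hM Ac).
by apply: compact_closedI; [exact: cube_compact|exact: orthant_closed].
Qed.

Lemma chart_in_orthant c x : AM c -> cdom c x -> (@orthant R d) (cfun c x).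
Proof.
move=> Ac cx; have [_ _ _ _ [W _ WE]] := fd_chart hM Ac.
have : (@orthant R d `&` W) (cfun c x) by rewrite -WE; exists x.
by case.
Qed.

(** A small cube intersected with the orthant is compact and lies in the chart image. Its preimage
    is compact, hence closed because [M] is Hausdorff, and therefore contains the closure of the
    preimage of the open cube. *)
Lemma precompact_nbhs x G : open G -> G x ->
  exists P : set M, [/\ open P, P x, closure P `<=` G & compact (closure P)].
Proof.
move=> oG Gx; have [hT _ _ /(_ x)[c Ac cx] _] := hM.
have hc := fd_chart hM Ac.
have [r r0 rG] := chart_cube Ac cx oG Gx.
pose K := chart_cell c (cfun c x) r.
have cK : compact K.
  apply: chart_cell_compact => //; apply: subset_trans rG _.
  by move=> _ [y [cy _] <-]; exists y.
have KG : K `<=` G.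
  move=> _ [y /rG [z [cz Gz] <-] <-].
  by rewrite (chartK hc cz).
pose P := cdom c `&` cfun c @^-1` (cube (cfun c x) r)°.
have oP : open P.
  apply: open_preim_cts (open_interior _); first exact: chart_open hc.
  exact: chart_cfun_cts hc.
have PK : P `<=` K.
  move=> y [cy Qy]; exists (cfun c y); last by rewrite (chartK hc cy).
  by split; [exact: interior_subset|exact: chart_in_orthant].
have clK : closure P `<=` K.
  by rewrite [K](proj1 (closure_id K) (compact_closed hT cK)); exact: closure_subset.
exists P; split => //.
- by split => //; exact: cube_nbhs.
- exact: subset_trans KG.
- by apply: subclosed_compact clK => //; exact: closed_closure.
Qed.

Lemma manifold_regular : locally_regular M.
Proof.
by move=> x G oG Gx; have [P [oP Px PG _]] := precompact_nbhs oG Gx; exists P.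
Qed.

End LocCompact.

(** * Smoothing over one chart *)

Section Blend.
Context {R : realType}.
Implicit Types X Y : tvsType R.

Definition blend (I : Type) Y (wt : I -> R) (val : I -> Y) (l : seq I) (y : Y) : Y :=
  foldr (fun i a => (1 - wt i) *: a + wt i *: val i) y l.

Lemma blend0 (I : eqType) Y wt val (l : seq I) (y : Y) :
  (forall i, i \in l -> wt i = 0) -> blend wt val l y = y.
Proof.
elim: l => //= i l IH H; rewrite IH; last by move=> j jl; apply: H; rewrite inE jl orbT.
by rewrite H ?inE ?eqxx// subr0 scale1r scale0r addr0.
Qed.

(** Only constants of nonzero weight have to be close to [s]; at a given point the bumps centred far
    away do not matter. *)
Lemma blend_convex (I : eqType) Y wt val (l : seq I) (y s : Y) (B : set Y) :
  convex_subset B -> (forall i, 0 <= wt i <= 1) ->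
  (forall i, i \in l -> wt i != 0 -> B (val i - s)) -> B (y - s) ->
  B (blend wt val l y - s).
Proof.
move=> cB wt01 + By; elim: l => //= i l IH H.
have {}IH : B (blend wt val l y - s).
  by apply: IH => j jl; apply: H; rewrite inE jl orbT.
have [->|wi] := eqVneq (wt i) 0; first by rewrite subr0 scale1r scale0r addr0.
have := cB _ _ _ IH (H i (mem_head _ _) wi) (wt01 i).
have -> // : (1 - wt i) *: (blend wt val l y - s) + wt i *: (val i - s) =
  (1 - wt i) *: blend wt val l y + wt i *: val i - s.
rewrite !scalerBr addrACA -opprD -scalerDl subrK scale1r //.
Qed.

Lemma blend_cvg (I T : Type) Y (F : set_system T) (FF : Filter F)
    (wt : I -> T -> R) wt0 val (l : seq I) (y : T -> Y) (y0 : Y) :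
  (forall i, wt i z @[z --> F] --> (wt0 i : R)) -> y z @[z --> F] --> y0 ->
  blend (wt^~ z) val l (y z) @[z --> F] --> blend wt0 val l y0.
Proof.
move=> wtc yc; elim: l => //= i l IH.
apply: tcvgD; last by apply: tcvgZ => //; exact: cvg_cst.
by apply: tcvgZ => //; apply: cvgB => //; exact: cvg_cst.
Qed.

Lemma Cn_onem n X (A : set X) (r : X -> R) : Cn n A (r : X -> R^o) ->
  Cn n A (fun x => 1 - r x : R^o).
Proof.
move=> Sr; apply: Cn_add; first exact: Cn_cst.
apply: (@Cn_eq _ n X R^o A (fun x => (-1) * r x : R^o)).
  by move=> x _; rewrite mulN1r.
by apply: Cn_mul => //; exact: Cn_cst.
Qed.

Lemma Cn_blend (I : Type) n X Y (A : set X) (wt : I -> X -> R) val (l : seq I) (y : X -> Y) :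
  (forall i, Cn n A (wt i : X -> R^o)) -> Cn n A y ->
  Cn n A (fun x => blend (wt^~ x) val l (y x)).
Proof.
move=> Sw Sy; elim: l => //= i l IH; apply: Cn_add.
  by apply: (@Cn_scale R n X Y A (fun x => 1 - wt i x)) => //; exact: Cn_onem.
by apply: (@Cn_scale R n X Y A (wt i)) => //; exact: Cn_cst.
Qed.

(* A weight equal to 1 erases the initial value. *)
Lemma Cn_blend1 (I : eqType) n X Y (A : set X) (wt : I -> X -> R) val (l : seq I)
    (y : X -> Y) i0 : i0 \in l -> (forall x, A x -> wt i0 x = 1) ->
  (forall i, Cn n A (wt i : X -> R^o)) ->
  Cn n A (fun x => blend (wt^~ x) val l (y x)).
Proof.
move=> + w1 Sw; elim: l => //= i l IH; rewrite inE => /orP[/eqP ii|/IH{}IH].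
  apply: (@Cn_eq _ n X Y A (fun=> val i)); last exact: Cn_cst.
  by move=> x Ax; rewrite -ii w1// subrr scale0r scale1r add0r.
apply: Cn_add.
  by apply: (@Cn_scale R n X Y A (fun x => 1 - wt i x)) => //; exact: Cn_onem.
by apply: (@Cn_scale R n X Y A (wt i)) => //; exact: Cn_cst.
Qed.

End Blend.

(** With time running over all of [R], continuity at t = 1 is two-sided. Constancy for t >= 1 is
    preserved by a step, whose weight in t is also constant there. *)
Definition stable_homotopy {R : realType} (M E : topologicalType) (pi : E -> M)
    (Om : set E) (F : R * M -> E) :=
  [/\ continuous F, forall t x, pi (F (t, x)) = x, forall t x, Om (F (t, x)) &
      forall t x, 1 <= t -> F (t, x) = F (1, x)].

Lemma cvg_pair_cst (S T : topologicalType) (a : S) (x : T) :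
  (a, z) @[z --> x] --> (a, x).
Proof. by apply: cvg_pair; [exact: cvg_cst|exact: cvg_id]. Qed.

Lemma cvg_swap (S T : topologicalType) (a : S) (x : T) :
  (p.2, p.1) @[p --> (x, a)] --> (a, x).
Proof. by apply: cvg_pair; [exact: cvg_snd|exact: cvg_fst]. Qed.

Lemma end_continuous {R : realType} (M E : topologicalType) (F : R * M -> E) t :
  continuous F -> continuous (fun x => F (t, x)).
Proof.
move=> Fc x; apply: (@cvg_comp _ _ _ (fun x => (t, x)) F _ (nbhs (t, x))); last exact: Fc.
exact: cvg_pair_cst.
Qed.

Section Step.
Context {R : realType} (d : nat) (M N E : topologicalType).
Variables (AM : set (chart M 'rV[R]_d)) (AN : @atlas R N) (AE : @atlas R E).
Variables (pi : E -> M) (U : set M) (phi : E -> M * N) (psi : M * N -> E).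
Hypothesis hM : fd_manifold_corners AM.
Hypothesis hN : lc_manifold AN.
Hypothesis hE : lc_manifold_corners AE.
Hypothesis pic : continuous pi.
Hypothesis oU : open U.
Hypothesis hphi : diffeo_on AE (prod_atlas (fd_atlas AM) AN)
  (pi @^-1` U) (U `*` setT) phi psi.
Hypothesis phi1 : forall e, U (pi e) -> (phi e).1 = pi e.
Variables (Y : tvsType R) (c : chart M 'rV[R]_d) (eta : chart N Y).
Hypothesis Ac : AM c.
Hypothesis Aeta : AN eta.

Variables (V UU K : set M) (Om : set E) (F : R * M -> E).
Hypothesis oV : open V.
Hypothesis cV : compact (closure V).
Hypothesis VU : closure V `<=` U.
Hypothesis Vc : closure V `<=` cdom c.
Hypothesis oUU : open UU.
Hypothesis oOm : open Om.
Hypothesis Ometa : forall e, Om e -> closure V (pi e) -> cdom eta (phi e).2.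
Hypothesis cK : closed K.
Hypothesis KV : K `<=` V `&` UU.
Hypothesis hF : stable_homotopy pi Om F.

Let Fc : continuous F. Proof. by case: hF. Qed.
Let Fs t x : pi (F (t, x)) = x. Proof. by case: hF. Qed.
Let FOm t x : Om (F (t, x)). Proof. by case: hF. Qed.
Let F1 t x : 1 <= t -> F (t, x) = F (1, x). Proof. by case: hF => _ _ _ +; exact. Qed.

Let hc : is_chart (@orthant R d) c := fd_chart hM Ac.
Let heta : is_chart setT eta := fib_chart hN Aeta.

Let y (z : R * M) : Y := cfun eta (phi (F z)).2.
Let s (x : M) : Y := y (1, x).

Let dom_F t x : closure V x -> cdom eta (phi (F (t, x))).2.
Proof. by move=> Vx; apply: Ometa => //; rewrite Fs. Qed.

Let phiF t x : U x -> phi (F (t, x)) = (x, (phi (F (t, x))).2).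
Proof. by move=> Ux; rewrite {1}[phi _]surjective_pairing phi1 Fs. Qed.

Let y_cvg t x : closure V x -> y z @[z --> (t, x)] --> y (t, x).
Proof.
move=> Vx; have Ux := VU Vx.
apply: (@cvg_comp _ _ _ (fun z => (phi (F z)).2) (cfun eta) _ (nbhs (phi (F (t, x))).2)).
  apply: (@cvg_comp _ _ _ F (fun e => (phi e).2) _ (nbhs (F (t, x)))); first exact: Fc.
  apply: (@cvg_comp _ _ _ phi snd _ (nbhs (phi (F (t, x))))); last exact: cvg_snd.
  apply: cts_interior (phi_cts hphi) _.
  apply: open_nbhs_nbhs; split; first exact: open_pre_U.
  by rewrite /preimage /= Fs.
apply: cts_interior (chart_cfun_cts heta) _.
apply: open_nbhs_nbhs; split; first exact: chart_open heta.
exact: dom_F.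
Qed.

Let s_cvg x : closure V x -> s z @[z --> x] --> s x.
Proof.
move=> Vx; apply: (@cvg_comp _ _ _ (fun z => (1 : R, z)) y _ (nbhs (1 : R, x))).
  exact: cvg_pair_cst.
exact: y_cvg.
Qed.

Let im := cfun eta @` cdom eta.

Let ev (z : M * Y) : E := psi (z.1, cinv eta z.2).

Let im_open : open im.
Proof. by have [_ _ _ _ [W oW]] := heta; rewrite setTI /im => ->. Qed.

Let Uim_open : open (U `*` im). Proof. exact: open_setX. Qed.

Let ev_cts : cts (U `*` im) ev.
Proof.
apply: (@cts_comp _ _ _ _ (U `*` setT) (fun z => (z.1, cinv eta z.2)) psi).
- by move=> z [].
- apply: cts_pair; first by apply: continuous_cts; exact: continuous_fst.
  apply: (@cts_comp _ _ _ _ im snd (cinv eta)) => [z []//||].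
    by apply: continuous_cts; exact: continuous_snd.
  exact: chart_cinv_cts heta.
- exact: psi_cts hphi.
Qed.

(** The admissible pairs: a base point with a fibre coordinate that defines a point of [E] lying in
    [Om]. *)
Let G := U `*` im `&` ev @^-1` Om.

Let G_open : open G. Proof. exact: open_preim_cts. Qed.

Let ev_y t x : closure V x -> ev (x, y (t, x)) = F (t, x).
Proof.
move=> Vx; rewrite /ev /y /= (chartK heta); last exact: dom_F.
by rewrite -phiF ?(phiK hphi)// ?Fs; exact: VU.
Qed.

Let G_y t x : closure V x -> G (x, y (t, x)).
Proof.
move=> Vx; split; last by rewrite /preimage /= ev_y.
by split; [exact: VU|exists (phi (F (t, x))).2 => //; exact: dom_F].
Qed.

Let tube : exists B : set Y, [/\ open B, B 0, convex_subset B &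
  forall x b, closure V x -> B b -> G (x, s x + b)].
Proof.
have /compact_near_coveringP cC := cV.
have H : \forall b \near (0 : Y), closure V `<=` [set x | G (x, s x + b)].
  apply: (cC Y (nbhs (0 : Y)) (fun b x => G (x, s x + b))) => x Vx.
  have : (p.1, s p.1 + p.2) @[p --> (x, (0 : Y))] --> (x, s x + 0).
    apply: cvg_pair; first exact: cvg_fst.
    apply: tcvgD; last exact: cvg_snd.
    apply: (@cvg_comp _ _ _ fst s _ (nbhs x)); first exact: cvg_fst.
    exact: s_cvg.
  rewrite addr0 => /(_ G); apply; apply: open_nbhs_nbhs; split => //.
  exact: G_y.
have [B [oB B0 BH cB]] := nbhs_convex H.
by exists B; split => // x b Vx /BH; apply.
Qed.

Lemma homotopy_step : exists F' : R * M -> E,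
  [/\ stable_homotopy pi Om F',
      forall t x, t <= 0 -> F' (t, x) = F (t, x),
      forall t x, ~ (V `&` UU) x -> F' (t, x) = F (t, x),
      forall x, smooth_at AM AE (fun x => F (1, x)) x ->
        smooth_at AM AE (fun x => F' (1, x)) x &
      forall x, K x -> smooth_at AM AE (fun x => F' (1, x)) x].
Proof.
have [B [oB B0 cB BG]] := tube.
(* From time 1 - e on, [y (t, x)] differs from [s x] by an element of [B], uniformly by compactness,
   so that blending it with the constants stays admissible. The bound e <= 1 leaves all times t <= 0
   untouched. *)
have [e /andP[e0 e1] He] : exists2 e : R, 0 < e <= 1 &
    forall t x, 1 - e <= t -> closure V x -> B (y (t, x) - s x).
  have /compact_near_coveringP cC := cV.
  have : \forall t \near (1 : R), closure V `<=` [set x | B (y (t, x) - s x)].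
    apply: (cC R (nbhs (1 : R)) (fun t x => B (y (t, x) - s x))) => x Vx.
    have : y (p.2, p.1) - s p.1 @[p --> (x, (1 : R))] --> y (1, x) - s x.
      apply: tcvgB.
        apply: (@cvg_comp _ _ _ (fun p : M * R => (p.2, p.1)) y _ (nbhs (1 : R, x))).
          exact: cvg_swap.
        exact: y_cvg.
      apply: (@cvg_comp _ _ _ fst s _ (nbhs x)); first exact: cvg_fst.
      exact: s_cvg.
    rewrite subrr => /(_ B); apply; exact: open_nbhs_nbhs.
  move=> [e /= e0 He]; exists (Num.min (e / 2) 1).
    by rewrite lt_min ltr01 divr_gt0//= ge_min lexx orbT.
  move=> t x te Vx; have [t1|t1] := leP 1 t.
    by rewrite /s /y F1// subrr.
  apply: He => //=; rewrite gtr0_norm ?subr_gt0//.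
  have : Num.min (e / 2) 1 <= e / 2 by rewrite ge_min lexx.
  lra.
pose w t := sstep ((t - 1 + e) / e).
have w0 t : t <= 1 - e -> w t = 0.
  by move=> te; rewrite /w sstep0// pmulr_lle0 ?invr_gt0//; lra.
have w1 t : 1 <= t -> w t = 1.
  by move=> t1; rewrite /w sstep1// ler_pdivlMr//; lra.
have wc t : w u @[u --> t] --> w t.
  apply: (@cvg_comp _ _ _ (fun u : R => (u - 1 + e) / e) (@sstep R) _
    (nbhs ((t - 1 + e) / e))).
    apply: cvgMl; apply: cvgD; last exact: cvg_cst.
    by apply: cvgB; [exact: cvg_id|exact: cvg_cst].
  by apply: (cts_interior (Cn_cts (@Cn_sstep R 0))); rewrite interiorT.
have w01 t : 0 <= w t <= 1 by exact: sstep_itv.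
(* The region in which the constant [s k] may be blended in. *)
pose Nb k := V `&` UU `&` [set x | B (s k - s x)].
have oNb k : open (Nb k).
  rewrite openE => x [[Vx Ux] Bx]; apply: filterI.
    by apply: open_nbhs_nbhs; split => //; exact: openI.
  have sc : s k - s z @[z --> x] --> s k - s x.
    by apply: tcvgB; [exact: cvg_cst|apply: s_cvg; exact: subset_closure].
  by apply: sc; exact: open_nbhs_nbhs.
(* A bump is indexed by a centre in [K] and a radius whose cell lies in the region of that centre.
   The sets [f p] use half the radius, where the bump equals 1. *)
pose D := [set p : M * R | [/\ K p.1, 0 < p.2 &
  cube (cfun c p.1) p.2 `&` @orthant R d `<=` cfun c @` (cdom c `&` Nb p.1)]].
pose f (p : M * R) := cdom c `&` cfun c @^-1` (cube (cfun c p.1) (p.2 / 2))°.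
have KcV : K `<=` closure V by move=> x /KV[Vx _]; exact: subset_closure.
have [|l Dl lK] := @compact_seq_cover M (M * R)%type D f K (subclosed_compact cK cV KcV).
  move=> x Kx; have cx := Vc (KcV x Kx).
  have Nx : Nb x x by split; [exact: KV|rewrite /= subrr].
  have [r r0 Hr] := chart_cube hM Ac cx (oNb x) Nx.
  exists (x, r) => //; split.
    apply: open_preim_cts (open_interior _); first exact: chart_open hc.
    exact: chart_cfun_cts hc.
  by split => //=; apply: cube_nbhs; rewrite divr_gt0.
pose beta (p : M * R) (x : M) : R := cube_bump (cfun c p.1) p.2 (cfun c x).
have b01 p x : 0 <= beta p x <= 1 by exact: cube_bump_itv.
pose cell (p : M * R) := chart_cell c (cfun c p.1) p.2.
have cellN p : p \in l -> cell p `<=` Nb p.1.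
  move=> /Dl[_ _ Hp] _ [a /Hp[z [cz Nz] <-] <-].
  by rewrite (chartK hc cz).
have b0 p x : p \in l -> cdom c x -> beta p x != 0 -> cell p x.
  move=> /Dl[_ r0 _] cx bn; exists (cfun c x); last by rewrite (chartK hc cx).
  split; last exact: (chart_in_orthant hM).
  move=> i; rewrite leNgt; apply/negP => /ltW ri; move/eqP: bn; apply.
  exact: cube_bump0 r0 ri.
(* The modification is confined to [S], which is closed as a finite union of compact cells and lies
   inside V and UU. *)
pose S := \bigcup_(p in [set` l]) cell p.
have cS : closed S.
  apply: closed_bigcup; first exact: finite_seq.
  move=> p /Dl[_ _ Hp]; have [hT _ _ _ _] := hM; apply: compact_closed => //.
  apply: (chart_cell_compact hM Ac); apply: subset_trans Hp _.
  by move=> _ [x [cx _] <-]; exists x.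
have SVU : S `<=` V `&` UU by move=> x [p pl /(cellN p pl)[]].
pose acc (z : R * M) : Y :=
  blend (fun p => w z.1 * beta p z.2) (fun p : M * R => s p.1) l (y z).
have wb01 t p x : 0 <= w t * beta p x <= 1.
  have /andP[? ?] := w01 t; have /andP[? ?] := b01 p x.
  by rewrite mulr_ge0//= mulr_ile1.
have acc_w0 t x : t <= 1 - e -> acc (t, x) = y (t, x).
  by move=> te; rewrite /acc blend0// => p _; rewrite /= w0// mul0r.
have acc_S t x : cdom c x -> ~ S x -> acc (t, x) = y (t, x).
  move=> cx nS; rewrite /acc blend0// => p pl /=.
  have [->|bn] := eqVneq (beta p x) 0; first by rewrite mulr0.
  by case: nS; exists p => //; exact: b0.
have acc_G t x : closure V x -> G (x, acc (t, x)).
  move=> Vx; have [te|te] := leP t (1 - e); first by rewrite acc_w0//; exact: G_y.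
  rewrite -[acc _](subrK (s x)) addrC; apply: BG => //.
  apply: blend_convex => //; last by apply: He => //; exact: ltW.
  move=> p pl; rewrite mulf_eq0 negb_or => /andP[_ bn].
  by have [_] := cellN p pl x (b0 p x pl (Vc Vx) bn).
(* The two branches agree on V outside S. As V and the complement of S form an open cover, [F'] is
   continuous. *)
pose F' (z : R * M) := if `[< V z.2 >] then ev (z.2, acc z) else F z.
have F'V t x : V x -> F' (t, x) = ev (x, acc (t, x)).
  by move=> Vx; rewrite /F' /=; case: asboolP.
have clV x : V x -> closure V x by exact: subset_closure.
have F'S t x : ~ S x -> F' (t, x) = F (t, x).
  move=> nS; have [Vx|nVx] := pselect (V x).
    by rewrite F'V// acc_S ?ev_y//; [exact: clV|exact/Vc/clV].
  by rewrite /F' /=; case: asboolP.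
have bc p x : V x -> beta p z @[z --> x] --> (beta p x : R).
  move=> Vx; apply: (@cvg_comp _ _ _ (cfun c) (cube_bump (cfun c p.1) p.2) _ (nbhs (cfun c x))).
    apply: cts_interior (chart_cfun_cts hc) _.
    apply: open_nbhs_nbhs; split; first exact: chart_open hc.
    exact/Vc/clV.
  by apply: (cts_interior (Cn_cts (@Cn_cube_bump R 0 _ (cfun c p.1) p.2))); rewrite interiorT.
have accc t x : V x -> acc z @[z --> (t, x)] --> acc (t, x).
  move=> Vx; apply: (@blend_cvg _ (M * R)%type (R * M)%type Y (nbhs (t, x)) _
    (fun p z => w z.1 * beta p z.2) (fun p => w t * beta p x)).
    move=> p; apply: cvgM.
      by apply: (@cvg_comp _ _ _ fst w _ (nbhs t)); [exact: cvg_fst|exact: wc].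
    by apply: (@cvg_comp _ _ _ snd (beta p) _ (nbhs x)); [exact: cvg_snd|exact: bc].
  by apply: y_cvg; exact: clV.
have F'c : continuous F'.
  move=> [t x]; have [Vx|nVx] := pselect (V x).
    rewrite /continuous_at F'V//.
    apply: (@cvg_trans _ (ev (z.2, acc z) @[z --> (t, x)])).
      apply: near_eq_cvg; apply: (@filterS _ _ _ (setT `*` V)).
        by move=> [u z] [_ Vz]; rewrite F'V.
      by apply: nbhs_setX; [exact: filterT|exact: open_nbhs_nbhs].
    apply: (@cvg_comp _ _ _ (fun z => (z.2, acc z)) ev _ (nbhs (x, acc (t, x)))).
      by apply: cvg_pair; [exact: cvg_snd|exact: accc].
    apply: (cts_interior ev_cts); apply: open_nbhs_nbhs; split => //.
    by have [] := acc_G t x (clV x Vx).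
  have nS : ~ S x by move=> /SVU[].
  rewrite /continuous_at F'S//.
  apply: (@cvg_trans _ (F z @[z --> (t, x)])); last exact: Fc.
  apply: near_eq_cvg; apply: (@filterS _ _ _ (setT `*` ~` S)).
    by move=> [u z] [_ nSz]; rewrite F'S.
  apply: nbhs_setX; first exact: filterT.
  by apply: open_nbhs_nbhs; split => //; exact: closed_openC.
have F's t x : pi (F' (t, x)) = x.
  rewrite /F'; case: asboolP => [/= Vx|_]; last exact: Fs.
  by rewrite (pi_psi hphi phi1)//=; exact/VU/clV.
have hF' : stable_homotopy pi Om F'.
  split => //.
    move=> t x; rewrite /F'; case: asboolP => [/= Vx|_]; last exact: FOm.
    by have [_] := acc_G t x (clV x Vx).
  move=> t x t1; rewrite /F' /=; case: asboolP => [/= Vx|_]; last exact: F1.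
  by rewrite /acc /= !w1// /y F1.
have tc' : continuous (fun x => F' (1, x)) by exact: end_continuous.
have tc : continuous (fun x => F (1, x)) by exact: end_continuous.
have fibE x : V x -> fib_coord phi eta (fun x => F' (1, x)) x = acc (1, x).
  move=> Vx; rewrite /fib_coord F'V// /ev (psiK hphi) /=; last exact/VU/clV.
  have [[_ [n en /= <-]] _] := acc_G 1 x (clV x Vx).
  by rewrite (chartK heta).
have dom_F' x : V x -> cdom eta (phi (F' (1, x))).2.
  by move=> Vx; apply: Ometa; [have [] := hF'|rewrite F's; exact: clV].
(* At time 1 the weight [w] is 1, so the fibre coordinate of [F'] is the blend of [s] with the bare
   bumps. *)
have Wsm W : open W -> W `<=` V ->
    (forall n, Cn n (cfun c @` W) (fun a =>
      blend (fun p => cube_bump (cfun c p.1) p.2 a) (fun p : M * R => s p.1) l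
        ((s \o cinv c) a))) ->
    smooth_on (fd_atlas AM) AE W (fun x => F' (1, x)).
  move=> oW WV SW; apply: (smooth_of_coord hM hN hE oU hphi phi1 Ac Aeta) => //.
  - by move=> x /WV/clV/VU.
  - by move=> x /WV/clV/Vc.
  - by move=> x /WV; exact: dom_F'.
  - move=> n; apply: Cn_eq (SW n) => _ [x Wx <-]; have Vx := WV x Wx.
    rewrite /= (chartK hc); last exact/Vc/clV.
    rewrite fibE// /acc /=; congr blend.
    by apply/funext => p; rewrite w1// mul1r.
have Sbump n A p : Cn n A (cube_bump (cfun c p.1) p.2 : 'rV[R]_d -> R^o).
  by apply: Cn_sub (Cn_cube_bump n (cfun c p.1) p.2).
exists F'; split => //.
- by move=> t x t0; rewrite /F'; case: asboolP => [/= Vx|//];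
    rewrite acc_w0 ?ev_y//; [exact: clV|lra].
- by move=> t x nVU; rewrite F'S// => /SVU.
- move=> x sx; have [Vx|nVx] := pselect (V x); last first.
    have nS : ~ S x by move=> /SVU[].
    apply: smooth_at_eq sx => //.
    apply: (@filterS _ _ _ (~` S)); first by move=> z nSz; rewrite F'S.
    by apply: open_nbhs_nbhs; split => //; exact: closed_openC.
  have [||||W [oW Wx WUc We SW]] :=
    coord_of_smooth hM hN hE pic oU hphi phi1 Ac Aeta tc _ sx _ _ _.
  + by move=> z; exact: Fs.
  + exact/VU/clV.
  + exact/Vc/clV.
  + by apply: dom_F; exact: clV.
  exists (W `&` V); split => //; first exact: openI.
  apply: Wsm; [exact: openI|by move=> z []|move=> n].
  apply: (@Cn_blend R (M * R)%type n _ Y _ (fun p => cube_bump (cfun c p.1) p.2)) => //.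
  by apply: Cn_sub (SW n) => _ [z [Wz _] <-]; exists z.
- move=> x Kx; have [p pl [cx px]] := lK x Kx.
  have [Vx _] := KV Kx.
  exists (f p `&` V); split.
  + apply: openI => //; apply: open_preim_cts (open_interior _); first exact: chart_open hc.
    exact: chart_cfun_cts hc.
  + by [].
  apply: Wsm; [|by move=> z []|move=> n].
    apply: openI => //; apply: open_preim_cts (open_interior _); first exact: chart_open hc.
    exact: chart_cfun_cts hc.
  apply: (@Cn_blend1 R (M * R)%type n _ Y _ (fun p => cube_bump (cfun c p.1) p.2) _ _ _ p) => //.
  move=> _ [z [[cz fz] _] <-]; have [_ r0 _] := Dl p pl.
  by apply: cube_bump1 => //; exact: (interior_subset fz).
Qed.

End Step.

(** * Smoothing over a locally finite cover *)

Section Assemble.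
Context {R : realType} (d : nat) (M E : topologicalType).
Variables (AM : set (chart M 'rV[R]_d)) (AE : @atlas R E).
Variables (pi : E -> M) (sigma : M -> E) (L UU : set M) (Om : set E).
Variables (VV : set (set M)) (K : set M -> set M).
Hypothesis hM : fd_manifold_corners AM.
Hypothesis hE : lc_manifold_corners AE.
Hypothesis sc : continuous sigma.
Hypothesis ss : is_section pi sigma.
Hypothesis sO : forall x, Om (sigma x).
Hypothesis smLU : forall x, L x -> ~ UU x -> smooth_at AM AE sigma x.
Hypothesis lf : loc_finite VV.
Hypothesis KB : forall B, VV B -> K B `<=` B.
Hypothesis Kcov : forall x, exists2 B, VV B & K B x.
Hypothesis step : forall B (C : set M) (F : R * M -> E), VV B ->
  closed C -> C `<=` B `&` UU -> stable_homotopy pi Om F ->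
  exists F' : R * M -> E,
  [/\ stable_homotopy pi Om F',
      forall t x, t <= 0 -> F' (t, x) = F (t, x),
      forall t x, ~ (B `&` UU) x -> F' (t, x) = F (t, x),
      forall x, smooth_at AM AE (fun x => F (1, x)) x ->
        smooth_at AM AE (fun x => F' (1, x)) x &
      forall x, C x -> smooth_at AM AE (fun x => F' (1, x)) x].
Hypothesis cL : closed L.
Hypothesis KBc : forall B, VV B -> closed (K B).

(** A set of members of the cover already treated, with the resulting homotopy. Points of [L]
    outside [UU] count as treated from the start: [sigma] is smooth there, and no step destroys
    smoothness. *)
Definition stage (p : set (set M) * (R * M -> E)) : Prop :=
  [/\ p.1 `<=` VV, stable_homotopy pi Om p.2,
      forall t x, t <= 0 -> p.2 (t, x) = sigma x,
      forall t x, ~ UU x -> p.2 (t, x) = sigma x &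
      forall x, L x -> (~ UU x \/ exists2 B, p.1 B & K B x) ->
        smooth_at AM AE (fun x => p.2 (1, x)) x].

(** The homotopy may change only over the newly added members. This makes the relation antisymmetric
    and lets chains stabilize near each point. *)
Definition stage_le (p q : set (set M) * (R * M -> E)) : Prop :=
  p.1 `<=` q.1 /\
  forall x, (forall B, q.1 B -> ~ p.1 B -> ~ B x) -> forall t, p.2 (t, x) = q.2 (t, x).

Lemma stage_le_trans p q r : stage_le p q -> stage_le q r -> stage_le p r.
Proof.
move=> [pq epq] [qr eqr]; split; first exact: subset_trans qr.
move=> x H t; rewrite epq; last by move=> B qB npB; apply: H => //; exact: qr.
by apply: eqr => B rB nqB; apply: H => // /pq.
Qed.

Lemma stage_le_anti p q : stage_le p q -> stage_le q p -> p = q.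
Proof.
case: p q => [J F] [J' F'] [/= JJ' e] [/= J'J _].
have {J'J}JE : J = J' by apply/seteqP.
subst J'; congr pair; apply/funext => -[t x].
by apply: e => B JB /(_ JB).
Qed.

(* Near a point only finitely many members of the cover matter, so that the
   stages of a chain are locally eventually constant. *)
Lemma chain_stage (A : set (set (set M) * (R * M -> E))) :
  (forall p, A p -> stage p) -> A !=set0 ->
  (forall p q, A p -> A q -> stage_le p q \/ stage_le q p) ->
  exists2 q, stage q & forall p, A p -> stage_le p q.
Proof.
move=> As [p0 Ap0] Atot.
pose Js := \bigcup_(p in A) p.1.
(* A stage of the chain containing every member of [Js] that meets a neighbourhood of [x]: there are
   finitely many, and the chain is total. *)
have loc x : exists pN : (set (set M) * (R * M -> E)) * set M,
    [/\ A pN.1, open_nbhs x pN.2 &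
     forall B, VV B -> B `&` pN.2 !=set0 -> Js B -> pN.1.1 B].
  have [N nN /finite_seqP[s sE]] := lf x.
  have [p Ap Hp] : exists2 p, A p & forall B, B \in s -> Js B -> p.1 B.
    elim: s {sE} => [|B s [p Ap Hp]]; first by exists p0.
    have [[q Aq qB]|nB] := pselect (Js B); last first.
      exists p => // B'; rewrite inE => /orP[/eqP ->//|]; exact: Hp.
    have [[pq _]|[qp _]] := Atot p q Ap Aq.
      by exists q => // B'; rewrite inE => /orP[/eqP -> //|B's JB']; exact/pq/Hp.
    by exists p => // B'; rewrite inE => /orP[/eqP -> _|]; [exact: qp|exact: Hp].
  exists (p, N°); split => //=; first by split; [exact: open_interior|].
  move=> B VB [y [By Ny]]; apply: Hp.
  have : [set B | VV B /\ B `&` N !=set0] B.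
    by split => //; exists y; split => //; exact: interior_subset.
  by rewrite sE.
have [P HP] := choice loc.
(* The value at a point is read off from the stage chosen there; by [agree], every stage containing
   all members of [Js] through that point gives the same. *)
pose Fs (z : R * M) := (P z.2).1.2 z.
have agree x p : A p -> (forall B, Js B -> B x -> p.1 B) ->
    forall t, p.2 (t, x) = Fs (t, x).
  move=> Ap Hp t; have [APx [oN Nx] HN] := HP x.
  have HN' B : VV B -> B x -> Js B -> (P x).1.1 B.
    by move=> VB Bx; apply: HN => //; exists x.
  rewrite /Fs /=; have [[_ e]|[_ e]] := Atot p (P x).1 Ap APx.
    by apply: e => B PB npB Bx; apply: npB; apply: Hp => //; exists (P x).1.
  apply/esym/e => B pB nPB Bx; apply: nPB; apply: HN' => //; last by exists p.
  by have [+ _ _ _ _] := As p Ap; exact.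
have agreeN x z : (P x).2 z -> forall t, Fs (t, z) = (P x).1.2 (t, z).
  move=> Nz t; have [APx _ HN] := HP x.
  apply/esym; apply: agree => // B JB Bz; apply: HN => //.
    by have [p Ap pB] := JB; have [+ _ _ _ _] := As p Ap; exact.
  by exists z.
have stP x : stage (P x).1 by have [/As] := HP x.
have Fsc : continuous Fs.
  move=> [t x]; have [_ nN _] := HP x.
  have [_ [Fc _ _ _] _ _ _] := stP x.
  rewrite /continuous_at (agreeN x)//; last by case: nN.
  apply: (@cvg_trans _ ((P x).1.2 z @[z --> (t, x)])); last exact: Fc.
  apply: near_eq_cvg; apply: (@filterS _ _ _ (setT `*` (P x).2)).
    by move=> [u z] [_ Nz]; rewrite /= (agreeN x z Nz).
  by apply: nbhs_setX; [exact: filterT|exact: open_nbhs_nbhs].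
exists (Js, Fs); last first.
  move=> p Ap; split; first by move=> B pB; exists p.
  move=> x H t; apply: agree => // B JB Bx.
  by apply: contrapT => npB; exact: (H B JB npB Bx).
split => /=.
- by move=> B [p Ap pB]; have [+ _ _ _ _] := As p Ap; exact.
- split => //.
  + by move=> t x; have [_ [_ H _ _] _ _ _] := stP x; exact: H.
  + by move=> t x; have [_ [_ _ H _] _ _ _] := stP x; exact: H.
  + by move=> t x; have [_ [_ _ _ H] _ _ _] := stP x; exact: H.
- by move=> t x; have [_ _ H _ _] := stP x; exact: H.
- by move=> t x; have [_ _ _ H _] := stP x; exact: H.
- move=> x Lx H; have [_ nN HN] := HP x.
  have [sub _ _ _ sm] := stP x.
  apply: (@smooth_at_eq _ _ _ _ _ _ hM hE (fun y => (P x).1.2 (1, y))).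
  + exact: end_continuous.
  + apply: (@filterS _ _ _ (P x).2); last exact: open_nbhs_nbhs.
    by move=> z Nz; rewrite (agreeN x z Nz).
  + apply: sm => //; case: H => [|[B JB KBx]]; [by left|right].
    exists B => //; have VB : VV B.
      by have [p Ap pB] := JB; have [+ _ _ _ _] := As p Ap; exact.
    by apply: HN => //; exists x; split; [exact: KB KBx|case: nN].
Qed.

Lemma exists_smoothing : exists2 F : R * M -> E, stable_homotopy pi Om F &
  [/\ forall t x, t <= 0 -> F (t, x) = sigma x,
      forall t x, ~ UU x -> F (t, x) = sigma x &
      forall x, L x -> smooth_at AM AE (fun x => F (1, x)) x].
Proof.
pose T := {p | stage p}.
pose rel_T : rel T := fun p q => `[< stage_le (sval p) (sval q) >].
have st0 : stage (set0, fun z => sigma z.2).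
  split => //=.
    split => //=.
    by move=> z; apply: (@continuous_comp _ _ _ snd sigma); [exact: cvg_snd|exact: sc].
  by move=> x Lx [nUx|[]//]; exact: smLU.
have [|||A Atot|m Hm] := @Zorn T rel_T.
- by move=> p; apply/asboolP; split.
- by move=> r p q /asboolP rp /asboolP pq; apply/asboolP; exact: stage_le_trans pq.
- move=> [p sp] [q sq] /asboolP/= pq /asboolP/= qp.
  by apply: eq_exist; exact: stage_le_anti.
- have [[p Ap]|nA] := pselect (A !=set0); last first.
    by exists (exist _ _ st0) => p Ap; case: nA; exists p.
  have [||| q sq Hq] := @chain_stage [set q | exists2 p : T, A p & sval p = q].
  + by move=> _ [[q sq] _ <-].
  + by exists (sval p), p.
  + move=> _ _ [q Aq <-] [r Ar <-]; have := Atot q r Aq Ar.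
    by case=> /asboolP; [left|right].
  exists (exist _ q sq) => r Ar; apply/asboolP; apply: Hq; by exists r.
have [[J F] sm mE] : exists2 p, stage p & forall q, stage q -> stage_le p q -> q = p.
  exists (sval m); first exact: (svalP m).
  move=> q sq mq; have := Hm (exist _ q sq); rewrite /rel_T /=.
  by move=> /(_ (introT (asboolP _) mq)) <-.
have [/= JV hF F0 FU FS] := sm.
have JE B : VV B -> J B.
  move=> VB; apply: contrapT => nJB.
  pose S := [set x | smooth_at AM AE (fun x => F (1, x)) x].
  have oS : open S.
    rewrite openE => x [W' [oW' W'x W't]].
    by apply: filterS (open_nbhs_nbhs (conj oW' W'x)) => y W'y; exists W'.
  (* Removing the open set [S] of points that are already smooth keeps the set closed and places it
     inside [UU], because the points of [L] outside [UU] belong to [S]. *)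
  have [|| F' [hF' F'0 F'V F'S F'C]] := step (C := K B `&` L `&` ~` S) VB _ _ hF.
  - apply: closedI; last exact: open_closedC.
    by apply: closedI => //; exact: KBc.
  - move=> x [[KBx Lx] nSx]; split; first exact: KB KBx.
    by apply: contrapT => nUx; apply: nSx; apply: FS => //; left.
  have : (J `|` [set B], F') = (J, F).
    apply: mE; split => //=.
    + by move=> B' [/JV//|->].
    + by move=> t x t0; rewrite F'0// F0.
    + by move=> t x nUx; rewrite F'V ?FU// => -[].
    + move=> x Lx H; have [Sx|nSx] := pselect (S x); first exact: F'S.
      case: H => [nUx|[B' [JB'|->] KBx]].
      * by apply: F'S; apply: FS => //; left.
      * by apply: F'S; apply: FS => //; right; exists B'.
      * exact: F'C.
    + move=> x H t; rewrite F'V// => -[Bx _].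
      by apply: (H B) => //; right.
  by move=> [JE _]; apply: nJB; rewrite -JE; right.
exists F => //; split => // x Lx; apply: FS => //.
by right; have [B VB KBx] := Kcov x; exists B => //; exact: JE.
Qed.

End Assemble.

(** * Choice of bundle charts and proof of the theorem *)

Theorem theorem0p11 (R : realType) (d : nat) (M N E : topologicalType)
    (AM : set (chart M 'rV[R]_d)) (AN : @atlas R N) (AE : @atlas R E)
    (pi : E -> M) (sigma : M -> E) (L U : set M) (O : set E)
    (hM : fd_manifold_corners AM) (hMconn : connected [set: M])
    (hN : lc_manifold AN) (hE : lc_manifold_corners AE)
    (hpi : locally_trivial (fd_atlas AM) AN AE pi)
    (hsigma : continuous sigma) (hsigma_sec : is_section pi sigma)
    (hL : closed L) (hU : open U)
    (hsmooth : smooth_near (fd_atlas AM) AE (L `\` U) sigma)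
    (hO : open O) (hsigmaO : range sigma `<=` O) :
  exists tau : M -> E,
    [/\ continuous tau, is_section pi tau, range tau `<=` O,
        smooth_near (fd_atlas AM) AE L tau &
        forall x, ~ U x -> tau x = sigma x] /\
    exists F : R * M -> E,
      [/\ {within `[0, 1] `*` [set: M], continuous F},
          forall t x, t \in `[0, 1] -> O (F (t, x)),
          forall x, F (0, x) = sigma x /\ F (1, x) = tau x,
          forall t, t \in `[0, 1] -> is_section pi (fun x => F (t, x)) &
          forall t x, t \in `[0, 1] -> ~ U x ->
            F (t, x) = sigma x /\ sigma x = tau x].

Proof.
have [_ [I [Ut [phi [psi [oUt covU hphi phi1]]]]]] := hpi.
have pic : continuous pi.
  by have [[/ctsP H _] _] := hpi => e; apply: cts_interior H _; rewrite interiorT.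
have [hTM pM _ covM _] := hM.
have [_ chN covN _] := hN.
(* [Q] is the domain in [E] of a bundle chart combined with a fibre chart. It is a separate
   parameter because one [Q] per member of the cover is chosen below. *)
pose good' (B : set M) (Q : set E) := exists t c Y (eta : chart N Y),
  [/\ AM c /\ AN _ eta, closure B `<=` Ut t `&` cdom c, compact (closure B),
      Q = pi @^-1` Ut t `&` phi t @^-1` (setT `*` cdom eta) &
      forall x, closure B x -> Q (sigma x)].
have goodQ B Q : good' B Q -> open Q.
  move=> [t [c [Y [eta [[_ Aeta] _ _ -> _]]]]]; apply: open_preim_cts.
  - by apply: open_comp => // e _; exact: pic.
  - exact: phi_cts (hphi t).
  - by apply: open_setX; [exact: openT|exact: chart_open (chN _ _ Aeta)].
have [||V [K [VP KP Kcov lf]]] :=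
  @shrink_cover M (fun B => exists Q, good' B Q) pM (manifold_regular hM).
- move=> B B' BB' [Q [t [c [Y [eta [? BU cB QE HQ]]]]]].
  have cBB' := closure_subset BB'.
  exists Q, t, c, Y, eta; split => //.
  + exact: subset_trans BU.
  + by apply: subclosed_compact cB cBB'; exact: closed_closure.
  + by move=> x /cBB'; exact: HQ.
- move=> x; have [t Utx] := covU x; have [c Ac cx] := covM x.
  have [Y [eta [Aeta etax]]] := covN (phi t (sigma x)).2.
  pose Q := pi @^-1` Ut t `&` phi t @^-1` (setT `*` cdom eta).
  have oQ : open Q.
    apply: open_preim_cts.
    - by apply: open_comp => // e _; exact: pic.
    - exact: phi_cts (hphi t).
    - by apply: open_setX; [exact: openT|exact: chart_open (chN _ _ Aeta)].
  have [||P [oP Px PG cP]] := @precompact_nbhs _ _ _ _ hM x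
      (Ut t `&` cdom c `&` sigma @^-1` Q).
  + apply: openI; first by apply: openI => //; exact: chart_open (fd_chart hM Ac).
    by apply: open_comp => // e _; exact: hsigma.
  + by split => //; split; [rewrite /preimage /= hsigma_sec|].
  exists P; split => //; exists Q, t, c, Y, eta; split => //.
  + by move=> z /PG[].
  + by move=> z /PG[].
have /choice[Q HQ] : forall B, exists Q, V B -> good' B Q.
  move=> B; have [VB|nVB] := pselect (V B); last by exists set0.
  by have [_ [Q gQ]] := VP B VB; exists Q.
(* The points over some closure of B that miss the chosen domain. The union is closed because the
   closures of the members of the cover are locally finite in [M], hence their preimages in [E]. *)
pose bad := \bigcup_(B in V) (pi @^-1` closure B `&` ~` Q B).
have cbad : closed bad.
  apply: lf_closed => [B VB|e].
    apply: closedI; last by apply: open_closedC; exact: goodQ (HQ B VB).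
    by apply: closed_comp; [move=> e _; exact: pic|exact: closed_closure].
  have [N' [oN' N'e] fN] := loc_finite_closure (pi e) lf.
  exists (pi @^-1` N').
    by apply: pic; exact: open_nbhs_nbhs.
  apply: sub_finite_set fN => B [VB [e' [[cB _] N'e']]]; split => //.
  by exists (pi e').
pose Om := O `&` ~` bad.
have OmQ B e : V B -> Om e -> closure B (pi e) -> Q B e.
  move=> VB [_ nbad] cB; apply: contrapT => nQ; apply: nbad.
  by exists B.
have sO x : Om (sigma x).
  split; first by apply: hsigmaO; exists x.
  by move=> [B VB [/= cB]]; apply; rewrite hsigma_sec in cB;
    have [t [c [Y [eta [_ _ _ _ H]]]]] := HQ B VB; exact: H.
have [||||||||||F hF [F0 FU FS]] := @exists_smoothing R d M E AM AE pi sigma L U Om V K hM hE.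
- exact: hsigma.
- exact: hsigma_sec.
- exact: sO.
- move=> x Lx nUx; have [W [oW LW] Wt] := hsmooth.
  by exists W; split => //; apply: LW.
- exact: lf.
- by move=> B /KP[].
- exact: Kcov.
- move=> B C F VB cC CBU hF.
  have [t [c [Y [eta [[Ac Aeta] BU cB QE _]]]]] := HQ B VB.
  apply: (homotopy_step hM hN hE pic (oUt t) (hphi t) (phi1 t) Ac Aeta) => //.
  + by have [] := VP B VB.
  + by move=> x /BU[].
  + by move=> x /BU[].
  + by apply: openI => //; exact: closed_openC.
  + by move=> e Ome cBe; have := OmQ B e VB Ome cBe; rewrite QE => -[_ []].
- exact: hL.
- by move=> B /KP[].
have [Fc Fs FO F1] := hF.
have tc : continuous (fun x => F (1, x)) by exact: end_continuous.
exists (fun x => F (1, x)); split.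
  split => //.
  - by move=> _ [x _ <-]; have [] := FO 1 x.
  - exact: smooth_near_at.
  - by move=> x nU; rewrite FU.
exists F; split.
- exact: continuous_subspaceT.
- by move=> t x _; have [] := FO t x.
- by move=> x; split => //; exact: F0.
- by move=> t _ x; exact: Fs.
- by move=> t x _ nU; rewrite !FU.
Qed.
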